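(* Let $\mathfrak{h}:\mathbb{T}^d\to\mathbb{T}^d$ be a block-slide type of map which commutes with $\phi^{1/q}$ for some natural number $q$. Then for any $\varepsilon>0$ and $\delta>0$, there exists a real-analytic diffeomorphism $h\in\mathrm{Diff}^{\omega}_{\infty}(\mathbb{T}^d,\mu)$ satisfying the following conditions: 1. (Proximity property) There exists a set $E\subset\mathbb{T}^d$ such that $\mu(E)<\delta$ and $\sup_{x\in\mathbb{T}^d\setminus E}\|h(x)-\mathfrak{h}(x)\|<\varepsilon$. 2. (Commuting property) $h\circ\phi^{1/q}=\phi^{1/q}\circ h$.
   Context: $\mathbb{T}^d=\mathbb{R}^d/\mathbb{Z}^d$, and $\mu$ is the standard Lebesgue measure on $\mathbb{T}^d$. $\phi^t(x_1,\dots,x_d)=(x_1+t,x_2,\dots,x_d)$ is the translation action of $\mathbb{T}^1$ on $\mathbb{T}^d$. $\|h(x)-\mathfrak{h}(x)\|$ denotes the distance in $\mathbb{T}^d$. A step function on the unit interval is a finite linear combination of indicator functions of intervals. For $1\le i,j\le d$ with $i\ne j$ and a step function $s$ on the unit interval, consider the map $\mathbb{T}^d\to\mathbb{T}^d$, $(x_1,\dots,x_d)\mapsto(x_1,\dots,x_i+s(x_j)\bmod 1,\dots,x_d)$ (only the $i$-th coordinate is changed). A block-slide type of map is any finite composition of maps of this kind. For $\rho>0$ let $\Omega_\rho=\{z\in\mathbb{C}^d: |\mathrm{Im}(z_i)|<\rho,\ i=1,\dots,d\}$, and let $C^\omega_\rho(\mathbb{T}^d)$ be the space of all $\mathbb{Z}^d$-periodic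 real-analytic functions $f:\mathbb{R}^d\to\mathbb{R}$ that extend to a holomorphic function on $\Omega_\rho$ with $\sup_{z\in\Omega_\rho}|f(z)|<\infty$. $\mathrm{Diff}^{\omega}_{\rho}(\mathbb{T}^d,\mu)$ is the set of all $\mu$-preserving real-analytic diffeomorphisms of $\mathbb{T}^d$ homotopic to the identity whose lift $F(x)=(x_1+f_1(x),\dots,x_d+f_d(x))$ and whose inverse's lift $\tilde F(x)=(x_1+\tilde f_1(x),\dots,x_d+\tilde f_d(x))$ satisfy $f_i,\tilde f_i\in C^\omega_\rho(\mathbb{T}^d)$ for all $i$. Finally $\mathrm{Diff}^{\omega}_{\infty}(\mathbb{T}^d,\mu)=\bigcap_{n=1}^\infty\mathrm{Diff}^{\omega}_{n}(\mathbb{T}^d,\mu)$. *)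

(* Defs.v *)
From HB Require Import structures.
From mathcomp Require Import all_boot all_order all_algebra.
From mathcomp Require Import complex finmap.
From mathcomp Require Import all_classical all_reals all_analysis.
From mathcomp.analysis Require showcase.summability.
Set Implicit Arguments.
Unset Strict Implicit.
Unset Printing Implicit Defensive.
Import Order.TTheory GRing.Theory Num.Theory.
Import numFieldNormedType.Exports.
Local Open Scope quotient_scope.
Local Open Scope classical_set_scope.
Local Open Scope ring_scope.

(* The library provides the sigma-algebra of n.-tuple T but no product measure
   on it: the Lebesgue measure on R^n is obtained from the binary product. *)
Section lebesgue_tuple.
Variable R : realType.

Section cons.
Variables (n : nat) (m : {sigma_finite_measure set (n.-tuple R) -> \bar R}).

Definition cons_tuple_pair (p : R * n.-tuple R) : n.+1.-tuple R :=
  [tuple of p.1 :: p.2].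

Lemma measurable_cons_tuple_pair : measurable_fun setT cons_tuple_pair.
Proof. exact: measurable_cons measurable_fst measurable_snd. Qed.

Definition lebesgue_cons : set (n.+1.-tuple R) -> \bar R :=
  pushforward (@lebesgue_measure R \x m)%E cons_tuple_pair.

Let lebesgue_cons0 : lebesgue_cons set0 = 0%E.
Proof. by rewrite /lebesgue_cons /pushforward preimage_set0 measure0. Qed.

Let lebesgue_cons_ge0 A : (0 <= lebesgue_cons A)%E.
Proof. by apply: integral_ge0 => x _; exact: measure_ge0. Qed.

Let lebesgue_cons_sigma_additive : semi_sigma_additive lebesgue_cons.
Proof.
apply: measure_semi_sigma_additive.
exact: measurable_cons_tuple_pair.
Qed.

HB.instance Definition _ := isMeasure.Build _ _ _ lebesgue_cons
  lebesgue_cons0 lebesgue_cons_ge0 lebesgue_cons_sigma_additive.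

Let lebesgue_cons_sigma_finite : sigma_finite setT lebesgue_cons.
Proof.
have /sigma_finiteP[F [UF ndF Ffin]] := sigma_finiteT (@lebesgue_measure R).
have /sigma_finiteP[G [UG ndG Gfin]] := sigma_finiteT m.
pose uncons (t : n.+1.-tuple R) : R * n.-tuple R := (thead t, [tuple of behead t]).
have muncons : measurable_fun setT uncons.
  apply/measurable_fun_pairP; split; first exact: measurable_tnth.
  exact: measurable_behead.
exists (fun k => uncons @^-1` (F k `*` G k)).
  rewrite -preimage_bigcup -[LHS](preimage_setT uncons); congr (_ @^-1` _).
  rewrite -setXTT UF UG predeqE => -[x y]; split=> [[/= [i _ Fx] [j _ Gy]]|].
    exists (maxn i j) => //; split.
    - by move: x Fx; exact/subsetPset/ndF/leq_maxl.
    - by move: y Gy; exact/subsetPset/ndG/leq_maxr.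
  by move=> [k _ []/= ? ?]; split; exists k.
move=> k; have [mF Fk] := Ffin k; have [mG Gk] := Gfin k; split.
  rewrite -[X in measurable X]setTI; apply: muncons => //.
  exact: measurableX.
rewrite /lebesgue_cons /pushforward -comp_preimage.
rewrite (_ : uncons \o cons_tuple_pair = id); last first.
  apply/funext => -[x t] /=; rewrite /uncons /cons_tuple_pair/= theadE.
  by congr pair; exact/val_inj.
by rewrite preimage_id product_measure1E// lte_mul_pinfty// ge0_fin_numE.
Qed.

HB.instance Definition _ := Measure_isSigmaFinite.Build _ _ _ lebesgue_cons
  lebesgue_cons_sigma_finite.

End cons.

Fixpoint lebesgue_tuple n : {sigma_finite_measure set (n.-tuple R) -> \bar R} :=
  if n is n'.+1 then lebesgue_cons (lebesgue_tuple n')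
  else @dirac _ _ [tuple] R.

End lebesgue_tuple.

Section torus.
Variables (R : realType) (d : nat).

Definition integer_vector : {pred 'rV[R]_d} :=
  [pred v : 'rV[R]_d | [forall i, v 0 i \is a Num.int]].

Lemma integer_vector_zmod_closed : zmod_closed integer_vector.
Proof.
split=> [|v w /forallP vZ /forallP wZ]; apply/forallP => i.
  by rewrite mxE rpred0.
by rewrite !mxE rpredB.
Qed.

HB.instance Definition _ :=
  GRing.isZmodClosed.Build 'rV[R]_d integer_vector integer_vector_zmod_closed.

Definition torus : Type :=
  quotient_topology (Quotient.quot integer_vector).

HB.instance Definition _ := PointedTopological.on torus.
HB.instance Definition _ := Quotient.on torus.
HB.instance Definition _ := GRing.Zmodule.copy torus
  (Quotient.quot integer_vector).

Definition tuple_row (t : d.-tuple R) : 'rV[R]_d := \row_i tnth t i.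

(* A subset of the torus is Borel iff its preimage in R^d is. *)
Definition torus_measurable : set (set torus) :=
  [set A | measurable ((fun t => \pi_torus (tuple_row t)) @^-1` A)].

Let torus_measurable0 : torus_measurable set0.
Proof. by rewrite /torus_measurable/= preimage_set0. Qed.

Let torus_measurableC A : torus_measurable A -> torus_measurable (~` A).
Proof. by rewrite /torus_measurable/= preimage_setC; exact: measurableC. Qed.

Let torus_measurable_bigcup (F : (set torus)^nat) :
  (forall k, torus_measurable (F k)) -> torus_measurable (\bigcup_k F k).
Proof.
by move=> mF; rewrite /torus_measurable/= preimage_bigcup; exact: bigcupT_measurable.
Qed.

HB.instance Definition _ := @isMeasurable.Build default_measure_display torus
  torus_measurable torus_measurable0 torus_measurableC torus_measurable_bigcup.

Definition unit_cube : set (d.-tuple R) :=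
  [set t | forall i, 0 <= tnth t i < 1].

Lemma measurable_unit_cube : measurable unit_cube.
Proof.
rewrite (_ : unit_cube = \bigcap_(i in [set: 'I_d])
    ((fun t => tnth t i) @^-1` [set` `[0, 1[%R])).
  apply: fin_bigcap_measurable => [|i _]; first exact: finite_finset.
  rewrite -[X in measurable X]setTI; apply: measurable_tnth => //.
apply/seteqP; split=> t /= ht i; first by move=> _; rewrite /= in_itv/=.
by have := ht i Logic.I; rewrite /= in_itv.
Qed.

(* computed on the fundamental domain [0, 1)^d *)
Definition torus_measure (A : set torus) : \bar R :=
  lebesgue_tuple R d
    ((fun t => \pi_torus (tuple_row t)) @^-1` A `&` unit_cube).

Let torus_measure0 : torus_measure set0 = 0%E.
Proof. by rewrite /torus_measure preimage_set0 set0I measure0. Qed.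

Let torus_measure_ge0 A : (0 <= torus_measure A)%E.
Proof. exact: measure_ge0. Qed.

Let torus_measure_sigma_additive : semi_sigma_additive torus_measure.
Proof.
move=> F mF tF mUF; rewrite /torus_measure preimage_bigcup setI_bigcupl.
apply: measure_semi_sigma_additive.
- by move=> k; apply: measurableI; [exact: mF|exact: measurable_unit_cube].
- apply/trivIsetP => i j _ _ ij; rewrite setIACA setIid -preimage_setI.
  by move/trivIsetP : tF => /(_ _ _ _ _ ij) ->//; rewrite preimage_set0 set0I.
- rewrite -setI_bigcupl -preimage_bigcup.
  by apply: measurableI; [exact: mUF|exact: measurable_unit_cube].
Qed.

HB.instance Definition _ := isMeasure.Build _ _ _ torus_measure
  torus_measure0 torus_measure_ge0 torus_measure_sigma_additive.

(* The supremum norm would give an equivalent distance. *)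
Definition torus_dist (x y : torus) : R :=
  inf [set Num.sqrt (\sum_i v 0 i ^+ 2) | v in [set v : 'rV[R]_d | \pi_torus v = x - y]].

Definition is_lift (h : torus -> torus) (F : 'rV[R]_d -> 'rV[R]_d) : Prop :=
  forall x, h (\pi_torus x) = \pi_torus (F x).

Definition homotopic_to_id (h : torus -> torus) : Prop :=
  exists H : R * torus -> torus,
    [/\ {within `[0, 1]%classic `*` setT, continuous H},
        forall x, H (0, x) = x & forall x, H (1, x) = h x].

Definition measure_preserving (h : torus -> torus) : Prop :=
  forall A, measurable A ->
    measurable (h @^-1` A) /\ torus_measure (h @^-1` A) = torus_measure A.

End torus.

Definition phi (R : realType) (d : nat) (t : R) (x : torus R d.+1) : torus R d.+1 :=
  x + \pi_(torus R d.+1) (t *: delta_mx 0 ord0).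

Section block_slide.
Variables (R : realType) (d : nat).

Definition step_function (s : R -> R) : Prop :=
  exists (n : nat) (c : 'I_n -> R) (J : 'I_n -> interval R),
    (forall k, [set` J k] `<=` `[0, 1]%classic) /\
    forall x, s x = \sum_k c k * \1_[set` J k] x.

(* The circle R/Z is identified with [0, 1): s is evaluated at the fractional
   part of the j-th coordinate of any lift. *)
Definition torus_coord (j : 'I_d) (x : torus R d) : R :=
  repr x 0 j - (Num.floor (repr x 0 j))%:~R.

Definition slide (i j : 'I_d) (s : R -> R) (x : torus R d) : torus R d :=
  x + \pi_(torus R d) (s (torus_coord j x) *: delta_mx 0 i).

Inductive block_slide : (torus R d -> torus R d) -> Prop :=
| block_slide_id : block_slide id
| block_slide_comp i j s g : i != j -> step_function s -> block_slide g ->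
    block_slide (slide i j s \o g).

End block_slide.

Section analytic.
Variables (R : realType) (d : nat).

(* Near every point, f is the unconditional sum of a power series. *)
Definition real_analytic (f : 'rV[R]_d -> R) : Prop :=
  forall x, exists r : R, 0 < r /\ exists c : {ffun 'I_d -> nat} -> R,
    forall y : 'rV[R]_d, (forall i, `|y 0 i| < r) ->
      summability.partial_sum (fun a : {ffun 'I_d -> nat} =>
        c a * \prod_i y 0 i ^+ a i) A @[A --> summability.totally] --> f (x + y).

Definition periodic (f : 'rV[R]_d -> R) : Prop :=
  forall x k, k \in @integer_vector R d -> f (x + k) = f x.

(* packed as a numFieldType so that the library's topology and differentials
   apply to it and to 'rV_d *)
Definition complexF : numFieldType := R[i].

Definition strip (rho : R) : set 'rV[complexF]_d :=
  [set z | forall i, `|complex.Im (z 0 i)| < rho].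

(* complex Frechet differentiability *)
Definition holomorphic_on (U : set 'rV[complexF]_d) (F : 'rV[complexF]_d -> complexF^o) : Prop :=
  forall z, U z -> differentiable F z.

Definition Comega (rho : R) (f : 'rV[R]_d -> R) : Prop :=
  [/\ periodic f, real_analytic f &
      exists F : 'rV[complexF]_d -> complexF^o,
        [/\ holomorphic_on (strip rho) F,
            forall x, F (map_mx (real_complex R) x) = (real_complex R (f x)) &
            exists M : R, forall z, strip rho z -> Normc.normc (F z) <= M]].

Definition shift_by (f : 'I_d -> 'rV[R]_d -> R) (x : 'rV[R]_d) : 'rV[R]_d :=
  \row_i (x 0 i + f i x).

(* That h is a real-analytic diffeomorphism is the analyticity of the lifts of
   h and of its inverse g, which is part of Comega. *)
Definition Diff_omega (rho : R) (h : torus R d -> torus R d) : Prop :=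
  [/\ measure_preserving h, homotopic_to_id h &
      exists (g : torus R d -> torus R d) (f ft : 'I_d -> 'rV[R]_d -> R),
        [/\ cancel h g /\ cancel g h,
            is_lift h (shift_by f), is_lift g (shift_by ft),
            forall i, Comega rho (f i) & forall i, Comega rho (ft i)]].

Definition Diff_omega_infty (h : torus R d -> torus R d) : Prop :=
  forall n : nat, (0 < n)%N -> Diff_omega n%:R h.

End analytic.

(* Main.v *)
Require Import Defs.
From mathcomp Require Import all_boot all_order all_algebra.
From mathcomp Require Import complex finmap zify ring lra.
From mathcomp Require Import all_classical all_reals all_analysis measurable_realfun.
From mathcomp.analysis Require showcase.summability.
Set Implicit Arguments.
Unset Strict Implicit.
Unset Printing Implicit Defensive.
Import Order.TTheory GRing.Theory Num.Theory.
Import numFieldNormedType.Exports.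
Local Open Scope quotient_scope.
Local Open Scope classical_set_scope.
Local Open Scope ring_scope.

(* Cut the torus into N^(d+1) cubes, N = q M.  Since hh preserves the measure,
   Hall's theorem gives a permutation tau of the cubes, commuting with the
   translation T by 1/q, such that hh maps some point of each cube z into tau z;
   as hh is a translation near most points, tau describes hh up to 2/N.
   The commutator of two shifts along lines of cubes is a 3-cycle of T-orbits.
   Such 3-cycles through a hub of measure 2/N move one orbit after the other to its
   place, so a product of T-invariant line shifts agrees with tau off the hub.
   A line shift is a shear by a product of indicators of intervals, and each
   indicator is a pointwise limit of trigonometric polynomials (1 - t^n)^(2^n),
   where t crosses 1/2 at the ends of the interval; Egorov's theorem makes the
   convergence uniform off a small set.  The shears so obtained and their
   compositions lift to maps built from constants, sums, products and cosines,
   which are entire and bounded on every strip. *)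

(** * Hall's theorem *)

Section hall.
Import mathcomp.boot.fintype mathcomp.boot.finset.
Local Open Scope set_scope.
Local Open Scope nat_scope.
Variable T : finType.
Implicit Types (r : rel T) (A B C : {set T}).

Definition rel_img r A : {set T} := [set w | [exists z in A, r z w]].

Lemma rel_imgP r A w : reflect (exists2 z, z \in A & r z w) (w \in rel_img r A).
Proof. by rewrite inE; exact: exists_inP. Qed.

Lemma hall_matching r A :
  (forall B, B \subset A -> #|B| <= #|rel_img r B|) ->
  exists f : T -> T, {in A &, injective f} /\ {in A, forall z, r z (f z)}.
Proof.
have [m leAm] := ubnP #|A|; elim: m => // m IH in r A leAm *; move=> hallA.
have [->|[a aA]] := set_0Vmem A.
  by exists id; split => [?|?]; rewrite inE.
case: (boolP [exists B : {set T}, [&& B \proper A, B != set0 & #|rel_img r B| <= #|B|]]).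
- move=> /existsP[B /and3P[BA B0 NB]].
  have BsA := proper_sub BA.
  have [||f1 [f1i f1r]] := IH r B.
  + exact: leq_trans (proper_card BA) _.
  + by move=> C CB; apply: hallA; exact: subset_trans CB BsA.
  pose r' z w := r z w && (w \notin rel_img r B).
  have [||f2 [f2i f2r]] := IH r' (A :\: B).
  + have := cardsD A B; rewrite (setIidPr BsA) => ->.
    by move: B0 (proper_card BA); rewrite -card_gt0; lia.
  + move=> C CAB.
    have CA : C \subset A by apply: subset_trans CAB (subsetDl _ _).
    have dBC : [disjoint B & C]%B.
      by move: CAB; rewrite subsetD disjoint_sym => /andP[].
    have := hallA (B :|: C); rewrite subUset BsA CA => /(_ isT).
    rewrite cardsU (disjoint_setI0 dBC) cards0 subn0.
    have -> : rel_img r (B :|: C) = rel_img r B :|: rel_img r' C.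
      apply/setP => w; rewrite in_setU; apply/rel_imgP/idP.
        move=> [z]; rewrite in_setU => /orP[zB|zC] rzw.
          by apply/orP; left; apply/rel_imgP; exists z.
        have [//|wN] := boolP (w \in rel_img r B).
        by rewrite orFb; apply/rel_imgP; exists z => //; rewrite /r' rzw.
      by move=> /orP[/rel_imgP[z zB rzw]|/rel_imgP[z zC /andP[rzw _]]];
        exists z; rewrite // inE ?zB ?zC ?orbT.
    by have := (leq_card_setU (rel_img r B) (rel_img r' C)).1; lia.
  have f1N z : z \in B -> f1 z \in rel_img r B.
    by move=> zB; apply/rel_imgP; exists z => //; exact: f1r.
  have f2N z : z \in A -> z \notin B -> f2 z \notin rel_img r B.
    by move=> zA zB; have /andP[] : r' z (f2 z) by apply: f2r; rewrite inE zB.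
  exists (fun z => if z \in B then f1 z else f2 z); split=> [x y xA yA|z zA].
  + case: ifPn => xB; case: ifPn => yB.
    * exact: f1i.
    * by move=> e; move: (f2N y yA yB); rewrite -e f1N.
    * by move=> e; move: (f2N x xA xB); rewrite e f1N.
    * by apply: f2i; rewrite inE ?xB ?yB.
  + case: ifPn => zB; first exact: f1r.
    by have /andP[] : r' z (f2 z) by apply: f2r; rewrite inE zB.
- move=> /existsPn tight.
  have /set0Pn[w wN] : rel_img r [set a] != set0.
    rewrite -card_gt0; apply: leq_trans (hallA _ _); rewrite ?cards1//.
    by rewrite sub1set.
  have raw : r a w by case/rel_imgP: wN => z /set1P->.
  pose r' z w' := r z w' && (w' != w).
  have [||f [fi fr]] := IH r' (A :\ a).
  + by have := cardsD1 a A; rewrite aA; lia.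
  + move=> C CA.
    have [->|C0] := eqVneq C set0; first by rewrite cards0.
    have ltC : C \proper A.
      by apply: sub_proper_trans CA _; rewrite properD1.
    have := tight C; rewrite ltC C0 /= -ltnNge => ltN.
    have sN : rel_img r C :\ w \subset rel_img r' C.
      apply/subsetP => v; rewrite !inE => /andP[vw /exists_inP[z zC rzv]].
      by apply/exists_inP; exists z => //; rewrite /r' rzv.
    by have := subset_leq_card sN; have := cardsD1 w (rel_img r C); lia.
  exists (fun z => if z == a then w else f z); split=> [x y xA yA|z zA].
  + have fN z : z \in A -> z != a -> f z != w.
      by move=> zA za; have /andP[] : r' z (f z) by apply: fr; rewrite !inE za.
    case: eqVneq => xa; case: eqVneq => ya.
    * by rewrite xa ya.
    * by move=> e; move: (fN y yA ya); rewrite -e eqxx.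
    * by move=> e; move: (fN x xA xa); rewrite e eqxx.
    * by apply: fi; rewrite !inE ?xa ?ya.
  + case: eqVneq => [->//|za].
    by have /andP[] : r' z (f z) by apply: fr; rewrite !inE za.
Qed.

End hall.

(** * Equivariant line shifts of cells *)

Section cells.
Variables (q M n : nat).
Hypotheses (q_gt0 : (0 < q)%N) (M_gt1 : (1 < M)%N).
Let N := (q * M)%N.
Local Notation cell := 'rV['Z_N]_n.+1.
Implicit Types (z w h u : cell) (i j : 'I_n.+1) (a b k : 'Z_N).

Definition unit_vec i : cell := delta_mx 0 i.
Local Notation e := unit_vec.

Definition shift_vec : cell := M%:R *: e ord0.
Local Notation T := shift_vec.

Definition same_orbit z h := [exists k, z == h + k *: T].

(* A line in direction i is taken with all its translates by T, so that shifting
   along it commutes with T. *)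
Definition same_line i z h := [exists k, [exists a, z == h + k *: T + a *: e i]].

Definition line_shift i u a z := if same_line i z u then z + a *: e i else z.

Inductive line_shifts : (cell -> cell) -> Prop :=
| line_shifts_id : line_shifts id
| line_shifts_comp i u a g : line_shifts g -> line_shifts (line_shift i u a \o g).

Lemma same_orbitP z h : reflect (exists k, z = h + k *: T) (same_orbit z h).
Proof. exact: 'exists_eqP. Qed.

Lemma same_lineP i z h :
  reflect (exists k a, z = h + k *: T + a *: e i) (same_line i z h).
Proof.
apply: (iffP existsP) => [[k /existsP[a /eqP ->]]|[k [a ->]]].
  by exists k, a.
by exists k; apply/existsP; exists a.
Qed.

Lemma same_orbit_refl z : same_orbit z z.
Proof. by apply/same_orbitP; exists 0; rewrite scale0r addr0. Qed.

Lemma same_orbit_sym z h : same_orbit z h -> same_orbit h z.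
Proof.
by case/same_orbitP => k ->; apply/same_orbitP; exists (- k); rewrite scaleNr addrK.
Qed.

Lemma same_orbit_trans z h u : same_orbit z h -> same_orbit h u -> same_orbit z u.
Proof.
move=> /same_orbitP[k ->] /same_orbitP[l ->]; apply/same_orbitP; exists (l + k).
by rewrite scalerDl addrA.
Qed.

Lemma same_orbitDr z h v : same_orbit (z + v) (h + v) = same_orbit z h.
Proof.
apply/same_orbitP/same_orbitP => [] [k zk]; exists k.
  by apply: (addIr v); rewrite zk addrAC.
by rewrite zk addrAC.
Qed.

Lemma same_lineDe i z h a : same_line i (z + a *: e i) h = same_line i z h.
Proof.
apply/same_lineP/same_lineP => [] [k [b zk]].
  by exists k, (b - a); rewrite scalerBl addrA -zk addrK.
by exists k, (b + a); rewrite zk scalerDl addrA.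
Qed.

Lemma same_lineDT i z h k : same_line i (z + k *: T) h = same_line i z h.
Proof.
apply/same_lineP/same_lineP => [] [l [b zk]].
  exists (l - k), b; apply: (addIr (k *: T)).
  by rewrite zk [RHS]addrAC -[X in _ = X + _]addrA -scalerDl subrK.
by exists (l + k), b; rewrite zk scalerDl addrA [LHS]addrAC.
Qed.

Lemma orbit_line i z h : same_orbit z h -> same_line i z h.
Proof.
move=> /same_orbitP[k ->]; apply/same_lineP; exists k, 0.
by rewrite scale0r addr0.
Qed.

Lemma same_line_refl i z : same_line i z z.
Proof. exact/orbit_line/same_orbit_refl. Qed.

Lemma line2_orbit i j z h : i != j ->
  same_line i z h -> same_line j z h -> same_orbit z h.
Proof.
move=> ij /same_lineP[k [a ->]] /same_lineP[l [b]] /eqP.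
rewrite -!addrA (inj_eq (addrI h)) => /eqP E.
have [i0|i0] := eqVneq i ord0; last first.
  have := congr1 (fun v : cell => v 0 i) E.
  rewrite /shift_vec /unit_vec !mxE /= (negbTE i0) (negbTE ij) eqxx !mulr0 !mulr1 !add0r => a0.
  by rewrite a0 scale0r addr0; apply/same_orbitP; exists k.
have j0 : j != ord0 by rewrite -i0 eq_sym.
have := congr1 (fun v : cell => v 0 j) E.
rewrite /shift_vec /unit_vec !mxE /= (negbTE j0) (eq_sym j i) (negbTE ij) eqxx !mulr0 !mulr1 !add0r => b0.
by rewrite E -b0 scale0r addr0; apply/same_orbitP; exists l.
Qed.

Lemma line_shiftDT i u a z k : line_shift i u a (z + k *: T) = line_shift i u a z + k *: T.
Proof. by rewrite /line_shift same_lineDT; case: ifP => // _; rewrite addrAC. Qed.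

Lemma line_shiftsDT g z k : line_shifts g -> g (z + k *: T) = g z + k *: T.
Proof. by elim=> //= i u a g' _ IH; rewrite IH line_shiftDT. Qed.

Lemma line_shiftK i u a : cancel (line_shift i u a) (line_shift i u (- a)).
Proof.
move=> z; rewrite /line_shift; case: (boolP (same_line i z u)) => zu; last by rewrite (negbTE zu).
by rewrite same_lineDe zu scaleNr addrK.
Qed.

Lemma line_shifts_inj g : line_shifts g -> injective g.
Proof. by elim=> //= i u a g' _ IH; exact/inj_comp/IH/can_inj/line_shiftK. Qed.

Lemma line_shifts_cat g g' : line_shifts g -> line_shifts g' -> line_shifts (g \o g').
Proof.
by move=> Gg Gg'; elim: Gg => // i u a f _ IH; rewrite -compA; constructor.
Qed.

(* The supports of the two shifts meet in the orbit of h only, so their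
   commutator is a 3-cycle of orbits. *)
Definition commutator i j h a b : cell -> cell :=
  line_shift i h a \o (line_shift j h b \o
    (line_shift i h (- a) \o (line_shift j h (- b) \o id))).

Lemma line_shifts_commutator i j h a b : line_shifts (commutator i j h a b).
Proof. by do !constructor. Qed.

Section commutator.
Variables (i j : 'I_n.+1) (h : cell) (a b : 'Z_N).
Hypotheses (ij : i != j) (ha : ~~ same_orbit (h + a *: e i) h)
  (hb : ~~ same_orbit (h + b *: e j) h).

Let line_iN c : same_line i (h + c *: e i) h.
Proof. by rewrite same_lineDe same_line_refl. Qed.

Let line_jN c : same_line j (h + c *: e j) h.
Proof. by rewrite same_lineDe same_line_refl. Qed.

Let ij_line z : ~~ same_orbit z h -> same_line i z h -> same_line j z h = false.
Proof. by move=> zh zi; apply/negbTE; exact: (contra (line2_orbit ij zi) zh). Qed.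

Let ji_line z : ~~ same_orbit z h -> same_line j z h -> same_line i z h = false.
Proof. by move=> zh zj; apply/negbTE; exact: (contra (fun zi => line2_orbit ij zi zj) zh). Qed.

Let orbitN c l : same_orbit (h + (- c) *: e l) h -> same_orbit (h + c *: e l) h.
Proof.
by move=> /same_orbit_sym; rewrite -(same_orbitDr _ _ (c *: e l)) scaleNr subrK.
Qed.

Lemma commutator_base : commutator i j h a b h = h + a *: e i.
Proof.
rewrite /commutator/= [X in line_shift i h (- a) X]/line_shift same_line_refl.
have hbN : ~~ same_orbit (h + (- b) *: e j) h by apply: contra hb; exact: orbitN.
rewrite [X in line_shift j h b X]/line_shift (ji_line hbN (line_jN _)).
rewrite [X in line_shift i h a X]/line_shift line_jN scaleNr subrK.
by rewrite /line_shift same_line_refl.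
Qed.

Lemma commutator_fst : commutator i j h a b (h + a *: e i) = h + b *: e j.
Proof.
rewrite /commutator/= [X in line_shift i h (- a) X]/line_shift.
rewrite (ij_line ha (line_iN _)).
rewrite [X in line_shift j h b X]/line_shift line_iN scaleNr addrK.
rewrite [X in line_shift i h a X]/line_shift same_line_refl.
by rewrite /line_shift (ji_line hb (line_jN _)).
Qed.

Lemma commutator_snd : commutator i j h a b (h + b *: e j) = h.
Proof.
rewrite /commutator/= [X in line_shift i h (- a) X]/line_shift.
rewrite line_jN scaleNr addrK.
rewrite [X in line_shift j h b X]/line_shift same_line_refl.
have haN : ~~ same_orbit (h + (- a) *: e i) h by apply: contra ha; exact: orbitN.
rewrite [X in line_shift i h a X]/line_shift (ij_line haN (line_iN _)).
by rewrite /line_shift line_iN scaleNr subrK.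
Qed.

Lemma commutator_out z : ~~ same_orbit z h -> ~~ same_orbit z (h + a *: e i) ->
  ~~ same_orbit z (h + b *: e j) -> commutator i j h a b z = z.
Proof.
move=> zh zi zj; rewrite /commutator/= [X in line_shift i h (- a) X]/line_shift.
case: ifPn => lj.
  have ljb : same_line j (z + (- b) *: e j) h by rewrite same_lineDe.
  have hz : ~~ same_orbit (z + (- b) *: e j) h.
    by apply: contra zj; rewrite -(same_orbitDr _ _ (b *: e j)) scaleNr subrK.
  rewrite [X in line_shift j h b X]/line_shift (ji_line hz ljb).
  rewrite [X in line_shift i h a X]/line_shift ljb scaleNr subrK.
  by rewrite /line_shift (ji_line zh lj).
rewrite [X in line_shift j h b X]/line_shift; case: ifPn => li; last first.
  rewrite [X in line_shift i h a X]/line_shift (negbTE lj).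
  by rewrite /line_shift (negbTE li).
have lia' : same_line i (z + (- a) *: e i) h by rewrite same_lineDe.
have hz : ~~ same_orbit (z + (- a) *: e i) h.
  by apply: contra zi; rewrite -(same_orbitDr _ _ (a *: e i)) scaleNr subrK.
rewrite [X in line_shift i h a X]/line_shift (ij_line hz lia').
by rewrite /line_shift lia' scaleNr subrK.
Qed.

End commutator.

Variable i1 : 'I_n.+1.
Hypothesis i1_neq0 : i1 != ord0.

(* The cells reserved for routing: a proportion at most 2 / N of all cells. *)
Definition hub z := (z 0 i1 == 0) || (z 0 i1 == 1).

Lemma N_gt1 : (1 < N)%N.
Proof. by rewrite /N (leq_trans M_gt1)// leq_pmull. Qed.

Lemma orbit_coord z h j : j != ord0 -> same_orbit z h -> z 0 j = h 0 j.
Proof.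
by move=> j0 /same_orbitP[k ->]; rewrite !mxE /= (negbTE j0) !mulr0 addr0.
Qed.

Lemma hub_orbit z h : same_orbit z h -> hub z = hub h.
Proof. by move=> zh; rewrite /hub (orbit_coord i1_neq0 zh). Qed.

Lemma unit_vec_orbit h j : ~~ same_orbit (h + e j) h.
Proof.
apply/negP => /same_orbitP[k /addrI /(congr1 (fun v : cell => v 0 j))].
rewrite /shift_vec /unit_vec !mxE !eqxx /=; case: (eqVneq j ord0) => j0; rewrite ?mulr0 ?mulr1; last first.
  by apply/eqP; exact: oner_neq0.
move=> /(congr1 (fun x : 'Z_N => x * q%:R)).
rewrite mul1r -mulrA -natrM mulnC -/N pchar_Zp ?N_gt1// mulr0.
move=> /(congr1 (fun x : 'Z_N => x : nat)); rewrite val_Zp_nat ?N_gt1//= modn_small => [q0|].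
  by move: q_gt0; rewrite q0.
by rewrite /N -[X in (X < _)%N]muln1 ltn_pmul2l.
Qed.

Section routing.
Variable S : {pred cell}.
Hypotheses (S_orbit : forall z h, same_orbit z h -> (z \in S) = (h \in S))
  (S_hub : forall z, hub z -> z \notin S).

Definition connected z w :=
  exists g, [/\ line_shifts g, {in S, g =1 id} & g z = w].

Lemma connected_refl z : connected z z.
Proof. by exists id; split => //; constructor. Qed.

Lemma connected_trans w z h : connected z w -> connected w h -> connected z h.
Proof.
move=> [g [Gg gS gz]] [f [Gf fS fw]]; exists (f \o g); split.
- exact: line_shifts_cat.
- by move=> x xS /=; rewrite gS// fS.
- by rewrite /= gz.
Qed.

Lemma connected_tri i j h a b : i != j -> ~~ same_orbit (h + a *: e i) h ->
  ~~ same_orbit (h + b *: e j) h -> h \notin S -> h + a *: e i \notin S ->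
  h + b *: e j \notin S ->
  connected h (h + a *: e i) /\ connected (h + a *: e i) h.
Proof.
move=> ij ha hb hS haS hbS; pose c := commutator i j h a b.
have cS : {in S, c =1 id}.
  move=> z zS; apply: commutator_out => //; apply/negP => /S_orbit.
  - by rewrite zS (negbTE hS).
  - by rewrite zS (negbTE haS).
  - by rewrite zS (negbTE hbS).
have Gc : line_shifts c by exact: line_shifts_commutator.
split; first by exists c; split => //; exact: commutator_base.
apply: (@connected_trans (h + b *: e j)); exists c; split => //.
  exact: commutator_fst.
exact: commutator_snd.
Qed.

Let proj z : cell := z - z 0 i1 *: e i1.

Let proj_coord z : proj z 0 i1 = 0.
Proof. by rewrite !mxE !eqxx /= mulr1 subrr. Qed.

Lemma connected_proj z : z \notin S -> connected z (proj z) /\ connected (proj z) z.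
Proof.
move=> zS; have [z0|z0] := eqVneq (z 0 i1) 0.
  by rewrite /proj z0 scale0r subr0; split; exact: connected_refl.
have zE : z = proj z + z 0 i1 *: e i1 by rewrite subrK.
have [] := @connected_tri i1 ord0 (proj z) (z 0 i1) 1.
- exact: i1_neq0.
- rewrite -zE; apply: contra z0 => /(orbit_coord i1_neq0).
  by rewrite proj_coord => ->.
- by rewrite scale1r unit_vec_orbit.
- by apply: S_hub; rewrite /hub proj_coord eqxx.
- by rewrite -zE.
- apply: S_hub; rewrite /hub !mxE /= !eqxx (negbTE i1_neq0).
  by rewrite !mulr1 mulr0 subrr addr0 eqxx.
by rewrite -zE.
Qed.

Lemma connected_step z i : z 0 i1 = 0 -> i != i1 ->
  connected z (z + e i) /\ connected (z + e i) z.
Proof.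
move=> z0 ii1; rewrite -[e i]scale1r; apply: (@connected_tri i i1 z 1 1) => //.
- by rewrite scale1r unit_vec_orbit.
- by rewrite scale1r unit_vec_orbit.
- by apply: S_hub; rewrite /hub z0 eqxx.
- apply: S_hub; rewrite /hub !mxE /= z0 [i1 == i]eq_sym (negbTE ii1).
  by rewrite !mulr0 addr0 eqxx.
- by apply: S_hub; rewrite /hub !mxE /= z0 !eqxx mulr1 add0r eqxx orbT.
Qed.

Lemma connected_steps z i k : z 0 i1 = 0 -> i != i1 ->
  connected z (z + k *: e i) /\ connected (z + k *: e i) z.
Proof.
move=> z0 ii1; rewrite -[k]natr_Zp; elim: (k : nat) => [|m [IH1 IH2]].
  by rewrite scale0r addr0; split; exact: connected_refl.
have m0 : (z + m%:R *: e i) 0 i1 = 0.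
  by rewrite !mxE /= [i1 == i]eq_sym (negbTE ii1) mulr0 z0 addr0.
have [s1 s2] := connected_step m0 ii1.
rewrite -[m.+1]addn1 natrD scalerDl scale1r addrA; split.
  exact: connected_trans IH1 s1.
exact: connected_trans s2 IH2.
Qed.

Lemma connected_hub z w : z 0 i1 = 0 -> w 0 i1 = 0 -> connected z w.
Proof.
move=> z0 w0; pose v := w - z.
have v0 : v 0 i1 = 0 by rewrite !mxE z0 w0 subr0.
have -> : w = z + \sum_i v 0 i *: e i by rewrite -row_sum_delta subrKC.
suff [] : connected z (z + \sum_i v 0 i *: e i) /\ (\sum_i v 0 i *: e i) 0 i1 = 0 by [].
apply: (big_rec (fun u => connected z (z + u) /\ u 0 i1 = 0)) => [|i u _ [zu u0]].
  by rewrite addr0 mxE; split => //; exact: connected_refl.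
have [->|ii1] := eqVneq i i1; first by rewrite v0 scale0r add0r.
have zu0 : (z + u) 0 i1 = 0 by rewrite mxE z0 u0 addr0.
rewrite addrCA addrC; split; last first.
  by rewrite /unit_vec !mxE u0 /= [i1 == i]eq_sym (negbTE ii1) mulr0 addr0.
exact: connected_trans zu (connected_steps _ zu0 ii1).1.
Qed.

Lemma connected_all z w : z \notin S -> w \notin S -> connected z w.
Proof.
move=> /connected_proj[zp _] /connected_proj[_ wp].
by apply: connected_trans zp (connected_trans _ wp); apply: connected_hub.
Qed.

End routing.

Lemma line_shifts_routing (tau : cell -> cell) : injective tau ->
  (forall z k, tau (z + k *: T) = tau z + k *: T) ->
  exists2 g, line_shifts g & forall z, ~~ hub (tau z) -> g z = tau z.
Proof.
move=> tau_inj tauT.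
have tau_bij : forall w, exists z, tau z = w.
  by move=> w; exists (invF tau_inj w); rewrite f_invF.
pose K (s : seq cell) : {pred cell} := [pred w | has (same_orbit w) s].
suff route s : all (predC hub) s ->
    exists2 g, line_shifts g & forall z, tau z \in K s -> g z = tau z.
  have [|g Gg gtau] := route [seq w <- enum {: cell} | ~~ hub w].
    by apply/allP => w; rewrite mem_filter => /andP[].
  exists g => // z hz; apply: gtau; rewrite inE; apply/hasP; exists (tau z).
    by rewrite mem_filter hz mem_enum.
  exact: same_orbit_refl.
elim: s => [_|r s IH /= /andP[hr /[dup] hs /IH[g Gg gtau]]].
  by exists id => //; constructor.
have K_orbit z h : same_orbit z h -> (z \in K s) = (h \in K s).
  by move=> zh; rewrite !inE; apply: eq_has => u; apply/idP/idP;
    apply: same_orbit_trans; rewrite // same_orbit_sym.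
have K_hub z : hub z -> z \notin K s.
  move=> hz; rewrite inE; apply/negP => /hasP[u us /hub_orbit zu].
  by move/allP : hs => /(_ _ us); rewrite /= -zu hz.
have [rK|rK] := boolP (r \in K s).
  exists g => // z; rewrite inE /= => /orP[zr|]; last exact: gtau.
  by apply: gtau; rewrite (K_orbit _ _ zr).
have [z0 z0r] := tau_bij r.
have gz0 : g z0 \notin K s.
  apply: contra rK => gK; have [z1 z1g] := tau_bij (g z0).
  have : g z1 = g z0 by rewrite gtau z1g.
  by move=> /(line_shifts_inj Gg) z10; rewrite -z0r -z10 z1g.
have [f [Gf fK fz]] := connected_all K_orbit K_hub gz0 rK.
exists (f \o g); first exact: line_shifts_cat.
move=> z; rewrite inE /= => /orP[/same_orbitP[k zk]|zK]; last first.
  by rewrite gtau// fK.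
have -> : z = z0 + k *: T by apply: tau_inj; rewrite tauT z0r.
by rewrite /= (line_shiftsDT _ _ Gg) (line_shiftsDT _ _ Gf) fz tauT z0r.
Qed.

End cells.
(** * Shears preserve the measure *)

Section lebesgue_shift.
Variable R : realType.
Local Notation mu := (@lebesgue_measure R).

Lemma lebesgue_measure_shift (c : R) (A : set R) : measurable A ->
  mu ((fun x => x + c) @^-1` A) = mu A.
Proof.
have mc : measurable_fun setT ((fun x => x + c) : measurableTypeR R -> measurableTypeR R).
  exact: measurable_funD.
move=> mA.
suff : mu A = pushforward mu ((fun x => x + c) : measurableTypeR R -> measurableTypeR R) A by [].
apply: lebesgue_measure_unique mA => _ [[a b] _ <-] /=.
rewrite /pushforward (_ : _ @^-1` _ = `]a - c, b - c]%classic); last first.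
  by apply/seteqP; split => x; rewrite /= !in_itv/= ltrBlDr lerBrDr.
by rewrite !lebesgue_measure_itv/= !lte_fin ltrD2r; case: ifP => // _;
  rewrite -!EFinB; congr EFin; ring.
Qed.

Lemma lebesgue_measure_rotation (c : R) (A : set R) : measurable A ->
  (forall x, A (x + 1) <-> A x) ->
  mu ((fun x => x + c) @^-1` A `&` `[0, 1[%classic) = mu (A `&` `[0, 1[%classic).
Proof.
move=> mA A1.
have AS (k : int) x : A (x + k%:~R) <-> A x.
  have An (m : nat) y : A (y + m%:R) <-> A y.
    elim: m y => [|m IH] y; first by rewrite addr0.
    by rewrite -natr1 addrA; split => [/A1/IH|/IH/A1].
  case: k => m; first exact: An.
  by rewrite NegzE mulrNz; split => [/(An m.+1)|Ax]; rewrite ?subrK//;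
    apply/(An m.+1); rewrite subrK.
pose f := c - (Num.floor c)%:~R.
have f0 : 0 <= f by rewrite /f subr_ge0 floor_le.
have f1 : f < 1 by rewrite /f ltrBlDr addrC -(intrD1) floorD1_gt.
have -> : (fun x => x + c) @^-1` A = (fun x => x + f) @^-1` A.
  apply/seteqP; split => x /=; rewrite /f => Ax.
    by apply/(AS (Num.floor c)); rewrite addrA subrK.
  by rewrite -(subrK (Num.floor c)%:~R c) addrA; apply/AS.
have mAI a b : measurable (A `&` `[a, b[%classic) by exact: measurableI.
have -> : (fun x => x + f) @^-1` A `&` `[0, 1[%classic =
    (fun x => x + f) @^-1` (A `&` `[f, 1 + f[%classic).
  apply/seteqP; split => x /= [Ax]; rewrite !in_itv/= => /andP[x0 x1]; split => //.
    by apply/andP; split; lra.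
  by apply/andP; split; lra.
rewrite lebesgue_measure_shift//.
have -> : A `&` `[f, 1 + f[ = (A `&` `[f, 1[) `|` (A `&` `[1, 1 + f[).
  rewrite -setIUr; congr (_ `&` _); apply/seteqP; split => x /=; rewrite !in_itv/=.
    by move=> /andP[h1 h2]; case: (ltP x 1) => hx; [left|right]; apply/andP; split.
  by case=> /andP[h1 h2]; apply/andP; split; lra.
have -> : A `&` `[0, 1[ = (A `&` `[f, 1[) `|` (A `&` `[0, f[).
  rewrite -setIUr; congr (_ `&` _); apply/seteqP; split => x /=; rewrite !in_itv/=.
    by move=> /andP[h1 h2]; case: (leP f x) => hx; [left|right]; apply/andP; split.
  by case=> /andP[h1 h2]; apply/andP; split; lra.
have dis a b c' d : b <= c' \/ d <= a ->
    (A `&` `[a, b[%classic) `&` (A `&` `[c', d[%classic) = set0.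
  move=> bc; apply/seteqP; split => // x /= [[_]].
  rewrite in_itv/= => /andP[h1 h2] [_]; rewrite in_itv/= => /andP[h3 h4].
  by case: bc; lra.
rewrite (measureU mu (mAI f 1) (mAI 1 (1 + f)) (dis _ _ _ _ _)); last by left.
rewrite (measureU mu (mAI f 1) (mAI 0 f) (dis _ _ _ _ _)); last by right.
congr (_ + _)%E; apply: (etrans (esym (lebesgue_measure_shift 1 (mAI 1 (1 + f))))).
congr (mu _); apply/seteqP; split => x /= [Ax]; rewrite in_itv/= => /andP[h1 h2].
  by split; [exact/A1|rewrite in_itv/=; apply/andP; split; lra].
by split; [exact/A1|rewrite in_itv/=; apply/andP; split; lra].
Qed.

End lebesgue_shift.

Section tuple_shear.
Variable R : realType.

Definition add_tnth n (i : 'I_n) (t : n.-tuple R) (c : R) : n.-tuple R :=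
  [tuple tnth t j + (if j == i then c else 0) | j < n].

Lemma add_tnth_cons0 n (x : R) (y : n.-tuple R) c :
  add_tnth ord0 [tuple of x :: y] c = [tuple of (x + c) :: y].
Proof.
apply: eq_from_tnth => j; rewrite tnth_mktuple.
by case: (unliftP ord0 j) => [k ->|->]; rewrite ?tnthS ?tnth0//= addr0.
Qed.

Lemma add_tnth_consS n (i : 'I_n) (x : R) (y : n.-tuple R) c :
  add_tnth (lift ord0 i) [tuple of x :: y] c = [tuple of x :: add_tnth i y c].
Proof.
apply: eq_from_tnth => j; rewrite tnth_mktuple.
case: (unliftP ord0 j) => [k ->|->]; rewrite ?tnthS ?tnth0/= ?addr0//.
by rewrite tnth_mktuple (inj_eq lift_inj).
Qed.

Lemma unit_cube_cons n (x : R) (y : n.-tuple R) :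
  unit_cube (R := R) [tuple of x :: y] <-> `[0, 1[%classic x /\ unit_cube y.
Proof.
rewrite /unit_cube/= in_itv/=; split=> [xy|[x01 y01] j].
  split; first by have := xy ord0; rewrite tnth0.
  by move=> j; have := xy (lift ord0 j); rewrite tnthS.
by case: (unliftP ord0 j) => [k ->|->]; rewrite ?tnthS ?tnth0.
Qed.

Lemma lebesgue_tuple_cube n : lebesgue_tuple R n (@unit_cube R n) = 1%E.
Proof.
elim: n => [|n IH] /=.
  by rewrite diracE mem_set// => -[].
rewrite /lebesgue_cons /pushforward.
have -> : @cons_tuple_pair R n @^-1` @unit_cube R n.+1 = `[0, 1[%classic `*` @unit_cube R n.
  by apply/seteqP; split => -[x y] /= /unit_cube_cons.
have E : @lebesgue_measure R `[0, 1[%classic = 1%E.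
  by rewrite lebesgue_measure_itv/= lte_fin ltr01 oppr0 adde0.
have mC := @measurable_unit_cube R n.
by rewrite product_measure1E// IH mule1; exact: E.
Qed.

Lemma lebesgue_tuple_shear n (i : 'I_n) (f : n.-tuple R -> R) (A : set (n.-tuple R)) :
  measurable_fun setT f -> (forall t c, f (add_tnth i t c) = f t) ->
  measurable A -> (forall t, A (add_tnth i t 1) <-> A t) ->
  lebesgue_tuple R n ((fun t => add_tnth i t (f t)) @^-1` A `&` @unit_cube R n) =
  lebesgue_tuple R n (A `&` @unit_cube R n).
Proof.
elim: n => [|n IH] in i f A *; first by case: i.
move=> mf fi mA Ai.
have mS : measurable_fun setT (fun t => add_tnth i t (f t)).
  apply/measurable_fun_tnthP => j.
  rewrite [X in measurable_fun _ X](_ : _ =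
      fun t => tnth t j + (if j == i then f t else 0)); last first.
    by apply/funext => t; rewrite /= tnth_mktuple.
  apply: measurable_funD; first exact: measurable_tnth.
  by case: (j == i).
have mSA : measurable ((fun t => add_tnth i t (f t)) @^-1` A).
  by rewrite -[X in measurable X]setTI; exact: mS.
have mC := @measurable_unit_cube R n.+1.
have mcons (B : set (n.+1.-tuple R)) : measurable B ->
    measurable (@cons_tuple_pair R n @^-1` B).
  by move=> mB; rewrite -[X in measurable X]setTI; exact: measurable_cons_tuple_pair.
rewrite /= /lebesgue_cons /pushforward.
case: (unliftP ord0 i) => [k ik|i0].
- rewrite /product_measure1; apply: eq_integral => x _ /=.
  have [x01|x01] := pselect (`[0, 1[%classic x); last first.
    congr (lebesgue_tuple R n _); apply/seteqP; split => y;
      by rewrite /xsection/= !inE/= => -[_ /unit_cube_cons[]].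
  have xsE (B : set (n.+1.-tuple R)) :
      xsection (@cons_tuple_pair R n @^-1` (B `&` @unit_cube R n.+1)) x =
      (fun y : n.-tuple R => B [tuple of x :: y]) `&` @unit_cube R n.
    apply/seteqP; split => y; rewrite /xsection/= inE/=.
      by move=> [By /unit_cube_cons[]].
    by move=> [By y01]; split => //; apply/unit_cube_cons.
  have mx : measurable_fun setT (fun y : n.-tuple R => [tuple of x :: y]).
    exact: measurable_cons.
  rewrite !xsE.
  have IHx := IH k (fun y => f [tuple of x :: y]) (fun y => A [tuple of x :: y]).
  rewrite -IHx => [||||].
  + congr (lebesgue_tuple R n (_ `&` _)); apply/seteqP; split => y /=;
      by rewrite ik add_tnth_consS.
  + exact: measurableT_comp mx.
  + by move=> y c; rewrite -add_tnth_consS -ik fi.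
  + by rewrite -[X in measurable X]setTI; exact: mx.
  + by move=> y; rewrite -(Ai [tuple of x :: y]) ik add_tnth_consS.
- pose leb : {sigma_finite_measure set (measurableTypeR R) -> \bar R} := @lebesgue_measure R.
  pose pm2 : {measure set (measurableTypeR R * n.-tuple R) -> \bar R} :=
    (leb \x^ lebesgue_tuple R n)%E.
  have pm12 (B : set (measurableTypeR R * n.-tuple R)) : measurable B ->
      (leb \x lebesgue_tuple R n)%E B = pm2 B.
    by apply: product_measure_unique => //= *; rewrite product_measure2E.
  transitivity (pm2 (@cons_tuple_pair R n @^-1`
      ((fun t => add_tnth i t (f t)) @^-1` A `&` @unit_cube R n.+1))).
    by apply: pm12; apply: mcons; exact: measurableI.
  transitivity (pm2 (@cons_tuple_pair R n @^-1` (A `&` @unit_cube R n.+1))); last first.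
    by apply/esym; apply: pm12; apply: mcons; exact: measurableI.
  rewrite /pm2/= /product_measure2; apply: eq_integral => y _ /=.
  have [y01|y01] := pselect (unit_cube y); last first.
    congr (lebesgue_measure _); apply/seteqP; split => x;
      by rewrite /ysection/= !inE/= => -[_ /unit_cube_cons[]].
  have ysE (B : set (n.+1.-tuple R)) :
      ysection (@cons_tuple_pair R n @^-1` (B `&` @unit_cube R n.+1)) y =
      (fun x : R => B [tuple of x :: y]) `&` `[0, 1[%classic.
    apply/seteqP; split => x; rewrite /ysection/= inE/=.
      by move=> [Bx /unit_cube_cons[]].
    by move=> [Bx x01]; split => //; apply/unit_cube_cons.
  have my : measurable_fun setT (fun x : R => [tuple of x :: y]).
    exact: measurable_cons.
  have rot := @lebesgue_measure_rotation R (f [tuple of 0 :: y]) (fun x => A [tuple of x :: y]).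
  rewrite !ysE -rot => [||x].
  + have f0 x : f [tuple of x :: y] = f [tuple of 0 :: y].
      by rewrite -(fi _ (- x)) i0 add_tnth_cons0 subrr.
    congr (lebesgue_measure (_ `&` _)); apply/seteqP; split => x /=;
      by rewrite i0 add_tnth_cons0 (f0 x).
  + by rewrite -[X in measurable X]setTI; exact: my.
  + by rewrite -add_tnth_cons0 -i0; exact: Ai.
Qed.

End tuple_shear.
Section torus_basics.
Variables (R : realType) (d : nat).
Local Notation torus := (torus R d).
Local Notation row := 'rV[R]_d.
Implicit Types (x y : torus) (v w : row) (i j : 'I_d).

Definition proj v : torus := \pi_torus v.

Lemma projD v w : proj (v + w) = proj v + proj w.
Proof. exact: (raddfD (\pi_(Quotient.quot (@integer_vector R d)))). Qed.

Lemma proj0 : proj 0 = 0.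
Proof. exact: (raddf0 (\pi_(Quotient.quot (@integer_vector R d)))). Qed.

Lemma projN v : proj (- v) = - proj v.
Proof. exact: (raddfN (\pi_(Quotient.quot (@integer_vector R d)))). Qed.

Lemma proj_eq v w : proj v = proj w <-> v - w \in @integer_vector R d.
Proof.
rewrite (Quotient.idealrBE (@integer_vector R d)); split.
  by move=> vw; apply/eqP.
by move/eqP.
Qed.

Lemma proj_repr x : proj (repr x) = x.
Proof. exact: reprK. Qed.

Lemma torusP x : exists v, x = proj v.
Proof. by exists (repr x); rewrite proj_repr. Qed.

Lemma proj_int v k : k \in @integer_vector R d -> proj (v + k) = proj v.
Proof. by move=> kZ; apply/proj_eq; rewrite addrC addKr. Qed.

Definition frac (a : R) : R := a - (Num.floor a)%:~R.

Lemma frac_ge0 a : 0 <= frac a.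
Proof. by rewrite subr_ge0 floor_le. Qed.

Lemma frac_lt1 a : frac a < 1.
Proof. by rewrite /frac ltrBlDr addrC -(intrD1) floorD1_gt. Qed.

Lemma fracDz a b : b \is a Num.int -> frac (a + b) = frac a.
Proof.
move=> /intrP[k ->]; rewrite /frac floorDrz ?intr_int//.
by rewrite intrKfloor rmorphD/=; ring.
Qed.

Lemma frac_id a : 0 <= a < 1 -> frac a = a.
Proof.
move=> /andP[a0 a1]; rewrite /frac (@floor_def _ _ 0) ?subr0//.
by rewrite a0.
Qed.

Lemma coord_proj j v : torus_coord j (proj v) = frac (v 0 j).
Proof.
have : v - repr (proj v) \in @integer_vector R d by apply/proj_eq; rewrite proj_repr.
rewrite inE => /forallP/(_ j); rewrite !mxE => vZ.
by rewrite /torus_coord -/(frac _) -(fracDz _ vZ) subrKC.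
Qed.

Lemma coord_ge0 j x : 0 <= torus_coord j x.
Proof. exact: frac_ge0. Qed.

Lemma coord_lt1 j x : torus_coord j x < 1.
Proof. exact: frac_lt1. Qed.

Lemma proj_coord x : x = proj (\row_j torus_coord j x).
Proof.
rewrite -[LHS]proj_repr; apply/proj_eq; rewrite inE; apply/forallP => j.
by rewrite !mxE /torus_coord subKr intr_int.
Qed.

Lemma coordD j x v : torus_coord j (x + proj v) = frac (torus_coord j x + v 0 j).
Proof. by rewrite {1}(proj_coord x) -projD coord_proj !mxE. Qed.

Definition unit_row i : row := delta_mx 0 i.
Local Notation e := unit_row.

Lemma unit_rowE i (c : R) j : (c *: e i) 0 j = if j == i then c else 0.
Proof. by rewrite !mxE /=; case: (j == i); rewrite ?mulr1 ?mulr0. Qed.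

Lemma projDint i (m : int) : proj (m%:~R *: e i) = 0.
Proof.
rewrite -proj0; apply/proj_eq; rewrite subr0 inE; apply/forallP => j.
by rewrite unit_rowE; case: ifP => _; rewrite ?intr_int ?rpred0.
Qed.

Definition tproj (t : d.-tuple R) : torus := proj (tuple_row t).

Lemma measurable_torusE (A : set torus) : measurable A <-> measurable (tproj @^-1` A).
Proof. by []. Qed.

Lemma measurable_torus_fun d' (T : measurableType d') (f : torus -> T) :
  measurable_fun setT (f \o tproj) -> measurable_fun setT f.
Proof.
move=> mf _ B mB; rewrite setTI; apply/measurable_torusE.
by rewrite -comp_preimage -[X in measurable X]setTI; exact: mf.
Qed.

Lemma measurable_tproj : measurable_fun setT tproj.
Proof. by move=> _ A mA; rewrite setTI; exact/measurable_torusE. Qed.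

Lemma measurable_torus_comp d' (T : measurableType d') (f : torus -> T) :
  measurable_fun setT f -> measurable_fun setT (f \o tproj).
Proof. by move=> mf; exact: measurableT_comp measurable_tproj. Qed.

Lemma measurable_floorR : measurable_fun setT (fun a : R => (Num.floor a)%:~R : R).
Proof.
apply: nondecreasing_measurable => // x y xy.
by rewrite ler_int le_floor.
Qed.

Lemma measurable_coord j : measurable_fun setT (@torus_coord R d j).
Proof.
apply: measurable_torus_fun.
rewrite [X in measurable_fun _ X](_ : _ =
    fun t : d.-tuple R => tnth t j - (Num.floor (tnth t j))%:~R); last first.
  by apply/funext => t /=; rewrite /tproj coord_proj mxE.
apply: measurable_funB; first exact: measurable_tnth.
exact: (measurableT_comp measurable_floorR (measurable_tnth j)).
Qed.

Lemma torus_measureT : torus_measure (setT : set torus) = 1%E.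
Proof. by rewrite /torus_measure preimage_setT setTI lebesgue_tuple_cube. Qed.

Definition shear i (f : torus -> R) x : torus := x + proj (f x *: e i).

Lemma shear_measure_preserving i f : measurable_fun setT f ->
  (forall x c, f (x + proj (c *: e i)) = f x) -> measure_preserving (shear i f).
Proof.
move=> mf fi A mA.
have addE (t : d.-tuple R) c : tproj (add_tnth i t c) = tproj t + proj (c *: e i).
  rewrite /tproj -projD; congr proj; apply/rowP => j.
  by rewrite !mxE tnth_mktuple -unit_rowE /unit_row !mxE.
have E : tproj @^-1` (shear i f @^-1` A) =
    (fun t => add_tnth i t (f (tproj t))) @^-1` (tproj @^-1` A).
  by apply/seteqP; split => t /=; rewrite /shear addE.
have mF := measurable_torus_comp mf.
have mS : measurable_fun setT (fun t => add_tnth i t (f (tproj t))).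
  apply/measurable_fun_tnthP => j.
  rewrite [X in measurable_fun _ X](_ : _ =
      fun t => tnth t j + (if j == i then f (tproj t) else 0)); last first.
    by apply/funext => t; rewrite /= tnth_mktuple.
  apply: measurable_funD; first exact: measurable_tnth.
  by case: (j == i).
split.
  by apply/measurable_torusE; rewrite E -[X in measurable X]setTI; exact: mS.
rewrite /torus_measure -/tproj E; apply: lebesgue_tuple_shear => //.
- by move=> t c; rewrite addE fi.
- by move=> t /=; rewrite addE (projDint i 1) addr0.
Qed.

Lemma measure_preserving_id : measure_preserving (@id torus).
Proof. by []. Qed.

Lemma measure_preserving_comp (g h : torus -> torus) :
  measure_preserving g -> measure_preserving h -> measure_preserving (g \o h).
Proof.
move=> mg mh A mA; have [mgA gA] := mg A mA; have [mhA hA] := mh _ mgA.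
by rewrite comp_preimage; split => //; rewrite hA.
Qed.

End torus_basics.
(** * Cells and their measure *)

Section equidistribution.
Variables (R : realType) (d : nat).
Local Notation torus := (torus R d).

Lemma torus_measureU (A B : set torus) : measurable A -> measurable B ->
  A `&` B = set0 -> torus_measure (A `|` B) = (torus_measure A + torus_measure B)%E.
Proof. exact: measureU. Qed.

Lemma torus_measureU_le (A B : set torus) : measurable A -> measurable B ->
  (torus_measure (A `|` B) <= torus_measure A + torus_measure B)%E.
Proof. exact: measureU2. Qed.

Lemma torus_measure_le (A B : set torus) : measurable A -> measurable B ->
  A `<=` B -> (torus_measure A <= torus_measure B)%E.
Proof. by move=> mA mB; apply: le_measure; rewrite inE. Qed.

Lemma translation_measure_preserving (v : 'rV[R]_d) :
  measure_preserving (fun x : torus => x + proj v).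
Proof.
rewrite (row_sum_delta v).
apply: (big_rec (fun w => measure_preserving (fun x : torus => x + proj w))) => [|i w _ IH].
  rewrite [X in measure_preserving X](_ : _ = id); last first.
    by apply/funext => x; rewrite proj0 addr0.
  exact: measure_preserving_id.
rewrite [X in measure_preserving X](_ : _ =
    (fun x : torus => x + proj w) \o shear i (fun=> v 0 i)); last first.
  by apply/funext => x; rewrite /shear /= projD addrA.
by apply: measure_preserving_comp IH _; exact: shear_measure_preserving.
Qed.

Lemma torus_measure_fibers (J : finType) (F : torus -> J) :
  (forall a, measurable [set x | F x = a]) ->
  (forall a b, torus_measure [set x | F x = a] = torus_measure [set x | F x = b]) ->
  forall A : pred J, measurable [set x | A (F x)] /\
    torus_measure [set x | A (F x)] = (#|A|%:R / #|J|%:R)%:E.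
Proof.
move=> mF eqF A.
have [x0] : exists x0 : torus, True by exists 0.
move=> _; pose p := torus_measure [set x | F x = F x0].
have step s : uniq s -> measurable [set x | F x \in s] /\
    torus_measure [set x | F x \in s] = ((size s)%:R%:E * p)%E.
  elim: s => [_|a s IH /= /andP[aNs /IH[ms es]]].
    rewrite (_ : [set x | F x \in [::]] = set0); last by apply/seteqP; split.
    by rewrite measure0 mul0e; split.
  rewrite (_ : [set x | F x \in a :: s] = [set x | F x = a] `|` [set x | F x \in s]).
    split; first exact: measurableU.
    rewrite torus_measureU//; last first.
      by apply/seteqP; split => // x [/= ->]; rewrite (negbTE aNs).
    rewrite es (eqF a (F x0)) -/p -{1}[p]mul1e -ge0_muleDl ?lee_fin//.
    by rewrite -EFinD nat1r.
  apply/seteqP; split => x /=; rewrite inE; first by move=> /orP[/eqP|]; [left|right].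
  by case=> ->; rewrite ?eqxx ?orbT.
have pfin : ((#|J|%:R)%:E * p)%E = 1%E.
  have [_] := step (enum J) (enum_uniq J); rewrite -cardE => <-.
  by rewrite -(torus_measureT R d); congr (torus_measure _);
    apply/seteqP; split => // x _ /=; rewrite mem_enum.
have J0 : (0 < #|J|%:R :> R) by rewrite ltr0n; apply/card_gt0P; exists (F x0).
have pE : p = (#|J|%:R^-1)%:E.
  move: pfin; have : (0 <= p)%E by exact: measure_ge0.
  clearbody p; case: (p) => [r| |] //.
    rewrite lee_fin => r0; rewrite -EFinM => -[] e; congr EFin.
    by apply: (mulfI (lt0r_neq0 J0)); rewrite e divff// lt0r_neq0.
  by move=> _; rewrite gt0_muley ?lte_fin.
have [] := step (enum A) (enum_uniq A).
rewrite -cardE pE -EFinM (_ : [set x | F x \in enum A] = [set x | A (F x)])//.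
by apply/seteqP; split => x /=; rewrite mem_enum.
Qed.

End equidistribution.

Section grid.
Variables (R : realType) (d N : nat).
Hypothesis N_gt1 : (1 < N)%N.
Local Notation torus := (torus R d).
Local Notation cells := 'rV['Z_N]_d.

Let N0 : (0 < N%:R :> R). Proof. by rewrite ltr0n ltnW. Qed.

Definition cell (x : torus) : cells :=
  \row_j (Num.floor (N%:R * torus_coord j x))%:~R.

Lemma cell_proj (v : 'rV[R]_d) j :
  cell (proj v) 0 j = (Num.floor (N%:R * v 0 j))%:~R.
Proof.
rewrite mxE coord_proj /frac mulrBr -mulrN -mulrNz.
rewrite -[N%:R in X in _ + X]/((Posz N)%:~R) -intrM floorDrz ?intr_int//.
rewrite intrKfloor intrD intrM -[(Posz N)%:~R]/(N%:R) pchar_Zp// mul0r addr0.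
by [].
Qed.

Definition cell_vector (z : cells) : 'rV[R]_d := \row_j ((z 0 j : nat)%:R / N%:R).

Lemma cellD (x : torus) (v : 'rV[R]_d) (z : cells) :
  (forall j, exists2 k : int, N%:R * v 0 j = k%:~R & z 0 j = k%:~R) ->
  cell (x + proj v) = cell x + z.
Proof.
move=> vz; have [w ->] := torusP x; rewrite -projD; apply/rowP => j.
have [k vk zk] := vz j.
transitivity (cell (proj w) 0 j + z 0 j); last by rewrite [in RHS]mxE.
rewrite !cell_proj mxE mulrDr vk floorDrz ?intr_int//.
by rewrite intrKfloor intrD zk.
Qed.

Lemma cellD_vector (x : torus) (z : cells) : cell (x + proj (cell_vector z)) = cell x + z.
Proof.
apply: cellD => j; exists (Posz (z 0 j)); last by rewrite -[LHS]natr_Zp.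
by rewrite mxE mulrC divfK// lt0r_neq0.
Qed.

Lemma cellD_unit (x : torus) i (k : nat) :
  cell (x + proj (k%:R / N%:R *: unit_row R i)) = cell x + k%:R *: delta_mx 0 i.
Proof.
apply: cellD => j; rewrite unit_rowE !mxE/=.
case: (j == i); last by exists 0; rewrite ?mulr0.
by exists (Posz k); rewrite ?mulr1// mulrC divfK// lt0r_neq0.
Qed.

Lemma torus_coord_floor (x : torus) j : exists2 k : nat, (k < N)%N &
  Num.floor (N%:R * torus_coord j x) = k.
Proof.
have f0 : 0 <= Num.floor (N%:R * torus_coord j x).
  by rewrite floor_ge0 mulr_ge0 ?coord_ge0// ltW.
exists `|Num.floor (N%:R * torus_coord j x)|%N; last by rewrite gez0_abs.
rewrite -ltz_nat gez0_abs// floor_lt_int -[X in _ < X]mulr1.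
by rewrite ltr_pM2l// coord_lt1.
Qed.

Lemma measurable_cell_coord j (a : 'Z_N) : measurable [set x : torus | cell x 0 j = a].
Proof.
have mf : measurable_fun setT (fun x : torus => (Num.floor (N%:R * torus_coord j x))%:~R : R).
  apply: (measurableT_comp (@measurable_floorR R)).
  by apply: measurable_funM => //; exact: measurable_coord.
have -> : [set x : torus | cell x 0 j = a] =
    \bigcup_(k in [set k : nat | k%:R = a])
      (fun x : torus => (Num.floor (N%:R * torus_coord j x))%:~R : R) @^-1` [set k%:R].
  apply/seteqP; split => x /=; rewrite mxE.
    by have [k _ xk] := torus_coord_floor x j; rewrite xk => ka; exists k => //=; rewrite xk.
  move=> [k /= ka e].
  by have -> : Num.floor (N%:R * torus_coord j x) = k by apply: (@intr_inj R); rewrite e.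
apply: bigcup_measurable => k _; rewrite -[X in measurable X]setTI.
by apply: mf => //; exact: measurable_set1.
Qed.

Lemma measurable_cell (z : cells) : measurable [set x : torus | cell x = z].
Proof.
have -> : [set x : torus | cell x = z] =
    \bigcap_(j in [set: 'I_d]) [set x | cell x 0 j = z 0 j].
  apply/seteqP; split => x /=; first by move=> xz j _ /=; rewrite xz.
  by move=> xz; apply/rowP => j; exact: xz.
apply: fin_bigcap_measurable => [|j _]; first exact: finite_finset.
exact: measurable_cell_coord.
Qed.

Lemma torus_measure_cell (A : pred cells) : measurable [set x : torus | A (cell x)] /\
  torus_measure [set x : torus | A (cell x)] = (#|A|%:R / #|{: cells}|%:R)%:E.
Proof.
apply: torus_measure_fibers; first exact: measurable_cell.
move=> z w; have [_ <-] := translation_measure_preserving (cell_vector (z - w)) (measurable_cell z).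
congr (torus_measure _); apply/seteqP; split => x /=; rewrite cellD_vector.
  by move=> e; apply: (addIr (z - w)); rewrite e subrKC.
by move=> ->; rewrite subrKC.
Qed.

Lemma torus_measure_cell_coord j (A : pred 'Z_N) :
  measurable [set x : torus | A (cell x 0 j)] /\
  torus_measure [set x : torus | A (cell x 0 j)] = (#|A|%:R / N%:R)%:E.
Proof.
have -> : N%:R = #|'Z_N|%:R :> R by rewrite card_ord Zp_cast.
apply: (torus_measure_fibers (F := fun x => cell x 0 j)); first exact: measurable_cell_coord.
move=> a b; have [_ <-] := translation_measure_preserving
  (cell_vector ((a - b) *: delta_mx 0 j)) (measurable_cell_coord j a).
congr (torus_measure _); apply/seteqP; split => x /=;
  rewrite cellD_vector !mxE !eqxx/= mulr1.
  by move=> e; apply: (addIr (a - b)); rewrite e subrKC.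
by move=> ->; rewrite subrKC.
Qed.

Lemma cell_close (x y : torus) : cell x = cell y ->
  exists2 v : 'rV[R]_d, y = x + proj v & forall j, `|v 0 j| < N%:R^-1.
Proof.
move=> xy; exists (\row_j torus_coord j y - \row_j torus_coord j x).
  by rewrite [X in X + _]proj_coord -projD subrKC -proj_coord.
move=> j; rewrite !mxE.
have /rowP/(_ j) := xy; rewrite !mxE.
have [k kN xk] := torus_coord_floor x j; have [l lN yl] := torus_coord_floor y j.
rewrite xk yl => /(congr1 (fun a : 'Z_N => (a : nat))).
rewrite !val_Zp_nat// !modn_small// => kl.
rewrite -(ltr_pM2l N0) divff ?lt0r_neq0// -[X in X * _]ger0_norm ?ler0n// -normrM mulrBr.
have := floor_itv (N%:R * torus_coord j x); have := floor_itv (N%:R * torus_coord j y).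
rewrite xk yl kl !intrD => /andP[h1 h2] /andP[h3 h4].
by rewrite ltr_norml; apply/andP; split; lra.
Qed.

End grid.
(** * Trigonometric functions of trigonometric functions *)

Section cos_lipschitz.
Variable R : realType.
Implicit Types a b : R.

Lemma cos_lipschitz a b : `|cos a - cos b| <= `|a - b|.
Proof.
wlog ab : a b / a <= b.
  by move=> H; case: (leP a b) => [/H//|/ltW/H]; rewrite distrC (distrC b).
have [|c _ e] := @MVT_segment R cos (fun x => - sin x) a b ab.
  by apply: continuous_subspaceT => x; exact: continuous_cos.
rewrite distrC e normrM normrN (distrC a) -[leRHS]mul1r.
by apply: ler_wpM2r => //; exact: sin_max.
Qed.

Lemma cosD2piz a (m : int) : cos (a + 2 * pi * m%:~R) = cos a.
Proof.
have nat_case b (n : nat) : cos (b + 2 * pi * n%:R) = cos b.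
  have -> : 2 * pi * n%:R = (pi *+ 2) *+ n :> R.
    by rewrite -[RHS]mulr_natr -[pi *+ 2]mulr_natl.
  exact: trigo.periodicn (@cosD2pi R) n b.
case: m => n; first exact: nat_case.
by rewrite NegzE mulrNz mulrN -(nat_case (a - _) n.+1) subrK.
Qed.

End cos_lipschitz.

Section trig.
Variables (R : realType) (d : nat).
Local Notation row := 'rV[R]_d.
Implicit Types (v w : row) (i j : 'I_d).

(* A class of entire periodic functions that is closed under the substitutions
   needed to compose shears: angles of cosines are again members of it. *)
Inductive trig :=
| TConst of R
| TAdd of trig & trig
| TMul of trig & trig
| TCos of nat & 'I_d & trig.

Fixpoint teval (t : trig) v : R :=
  match t with
  | TConst a => a
  | TAdd s t => teval s v + teval t v
  | TMul s t => teval s v * teval t v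
  | TCos k j s => cos (2 * pi * k%:R * v 0 j + teval s v)
  end.

Fixpoint tsubst (g : 'I_d -> trig) (t : trig) : trig :=
  match t with
  | TConst a => TConst a
  | TAdd s t => TAdd (tsubst g s) (tsubst g t)
  | TMul s t => TMul (tsubst g s) (tsubst g t)
  | TCos k j s => TCos k j (TAdd (TMul (TConst (2 * pi * k%:R)) (g j)) (tsubst g s))
  end.

Lemma teval_subst g t v :
  teval (tsubst g t) v = teval t (shift_by (fun i => teval (g i)) v).
Proof.
elim: t => //= [s -> t -> //|s -> t -> //|k j s ->]; congr (cos _).
by rewrite !mxE [in RHS]mulrDr -[in RHS]addrA.
Qed.

Lemma teval_periodic t : Defs.periodic (teval t).
Proof.
move=> v k kZ; elim: t => //= [s -> t -> //|s -> t -> //|m j s ->].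
have /intrP[z kz] : k 0 j \is a Num.int by move: kZ; rewrite inE => /forallP.
rewrite mxE kz -[RHS](cosD2piz _ (m%:Z * z)%R) intrM -[m%:Z%:~R]/(m%:R : R).
by congr (cos _); ring.
Qed.

Lemma teval_bounded t : exists2 M, 0 <= M & forall v, `|teval t v| <= M.
Proof.
elim: t => [a|s [M M0 sM] t [M' M'0 tM]|s [M M0 sM] t [M' M'0 tM]|k j s _].
- by exists `|a|.
- exists (M + M') => [|v]; first exact: addr_ge0.
  by rewrite /= (le_trans (ler_normD _ _))// lerD.
- exists (M * M') => [|v]; first exact: mulr_ge0.
  by rewrite /= normrM ler_pM.
- by exists 1 => // v /=; exact: cos_max.
Qed.

Lemma teval_lipschitz t : exists2 L, 0 <= L & forall v w e,
  (forall j, `|v 0 j - w 0 j| <= e) -> `|teval t v - teval t w| <= L * e.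
Proof.
elim: t => [a|s [L L0 sL] t [L' L'0 tL]|s [L L0 sL] t [L' L'0 tL]|k j s [L L0 sL]].
- by exists 0 => // v w e _ /=; rewrite subrr normr0 mul0r.
- exists (L + L') => [|v w e vw /=]; first exact: addr_ge0.
  rewrite opprD addrACA mulrDl (le_trans (ler_normD _ _))// lerD//.
    exact: sL.
  exact: tL.
- have [M M0 sM] := teval_bounded s; have [M' M'0 tM] := teval_bounded t.
  exists (M' * L + M * L') => [|v w e vw /=]; first by rewrite addr_ge0// mulr_ge0.
  have -> : teval s v * teval t v - teval s w * teval t w =
    teval t v * (teval s v - teval s w) + teval s w * (teval t v - teval t w) by ring.
  rewrite mulrDl (le_trans (ler_normD _ _))// !normrM -!mulrA lerD//.
    by apply: ler_pM => //; exact: sL.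
  by apply: ler_pM => //; exact: tL.
- have k0 : 0 <= 2 * pi * k%:R :> R by rewrite !mulr_ge0// pi_ge0.
  exists (2 * pi * k%:R + L) => [|v w e vw /=]; first exact: addr_ge0.
  apply: le_trans (cos_lipschitz _ _) _.
  rewrite opprD addrACA -mulrBr [leRHS]mulrDl.
  apply: le_trans (ler_normD _ _) _; apply: lerD.
    by rewrite normrM (ger0_norm k0) ler_wpM2l.
  exact: sL.
Qed.

Lemma teval_measurable t :
  measurable_fun setT (fun u : d.-tuple R => teval t (tuple_row u)).
Proof.
elim: t => [a|s IHs t IHt|s IHs t IHt|k j s IHs] /=.
- exact: measurable_cst.
- exact: measurable_funD.
- exact: measurable_funM.
- apply: (measurableT_comp (f := @cos R)).
    by apply: continuous_measurable_fun => x; exact: continuous_cos.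
  apply: measurable_funD => //; apply: measurable_funM => //.
  rewrite (_ : (fun u => _) = (fun u : d.-tuple R => tnth u j)); last first.
    by apply/funext => u; rewrite mxE.
  exact: measurable_tnth.
Qed.

Lemma teval_continuous t : continuous (teval t : row -> R).
Proof.
have [L L0 tL] := teval_lipschitz t.
move=> v; have F := nbhs_filter v; apply/cvgrPdist_le => e e0.
have e'0 : 0 < e / (L + 1) by rewrite divr_gt0// ltr_wpDl.
apply: filterS (nbhsx_ballx v _ e'0) => w H.
have vw j : `|v 0 j - w 0 j| <= e / (L + 1) by by apply: ltW; exact: (H.2 0 j).
apply: le_trans (tL _ _ _ vw) _.
rewrite mulrCA ler_piMr ?(ltW e0)// ler_pdivrMr ?mul1r ?lerDl//.
by rewrite ltr_wpDl.
Qed.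

End trig.
(** * Real analyticity *)

Section unconditional_sums.
Variable R : realType.

Lemma perm_sub (I : eqType) (s t : seq I) : uniq s -> uniq t -> {subset s <= t} ->
  perm_eq t (s ++ [seq i <- t | i \notin s]).
Proof.
move=> us ut st; apply: uniq_perm => //.
  rewrite cat_uniq us filter_uniq// andbT; apply/hasPn => i.
  by rewrite mem_filter => /andP[].
move=> i; rewrite mem_cat mem_filter; have [/st ->|] := boolP (i \in s) => //.
Qed.

Section one_family.
Variable I : eqType.
Implicit Types (f g : I -> R) (s t : seq I).

Definition has_sum f (S : R) := forall e, 0 < e ->
  exists s0, forall s, uniq s -> {subset s0 <= s} -> `|S - \sum_(i <- s) f i| <= e.

Definition abs_sum_le f (M : R) := forall s, uniq s -> \sum_(i <- s) `|f i| <= M.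

Lemma abs_sum_le_ge0 f M : abs_sum_le f M -> 0 <= M.
Proof. by move=> /(_ [::] isT); rewrite big_nil. Qed.

Lemma ler_sum_sub f s t : (forall i, 0 <= f i) -> uniq s -> uniq t ->
  {subset s <= t} -> \sum_(i <- s) f i <= \sum_(i <- t) f i.
Proof.
move=> f0 us ut st; rewrite (perm_big _ (perm_sub us ut st))/= big_cat/= lerDl.
exact: sumr_ge0.
Qed.

Lemma has_sum_unique f S S' : has_sum f S -> has_sum f S' -> S = S'.
Proof.
move=> fS fS'; apply/eqP; rewrite -subr_eq0 -normr_le0.
apply/ler_addgt0Pr => e e0; rewrite add0r.
have [s0 h0] := fS _ (divr_gt0 e0 (ltr0n _ 2)); have [s1 h1] := fS' _ (divr_gt0 e0 (ltr0n _ 2)).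
pose s := undup (s0 ++ s1).
have us : uniq s by exact: undup_uniq.
have h0' := h0 s us; have h1' := h1 s us.
have -> : S - S' = (S - \sum_(i <- s) f i) - (S' - \sum_(i <- s) f i) by ring.
rewrite [e](splitr e) (le_trans (ler_normB _ _))// lerD//.
  by apply: h0' => i si; rewrite mem_undup mem_cat si.
by apply: h1' => i si; rewrite mem_undup mem_cat si orbT.
Qed.

Lemma has_sumD f g S S' : has_sum f S -> has_sum g S' ->
  has_sum (fun i => f i + g i) (S + S').
Proof.
move=> fS gS e e0.
have [s0 h0] := fS _ (divr_gt0 e0 (ltr0n _ 2)); have [s1 h1] := gS _ (divr_gt0 e0 (ltr0n _ 2)).
exists (s0 ++ s1) => s us ss; rewrite big_split/= opprD addrACA [e](splitr e).
rewrite (le_trans (ler_normD _ _))// lerD//.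
  by apply: h0 => // i si; apply: ss; rewrite mem_cat si.
by apply: h1 => // i si; apply: ss; rewrite mem_cat si orbT.
Qed.

Lemma has_sumZ f S c : has_sum f S -> has_sum (fun i => c * f i) (c * S).
Proof.
move=> fS e e0; have e'0 : 0 < e / (`|c| + 1) by rewrite divr_gt0// ltr_wpDl.
have [s0 h0] := fS _ e'0; exists s0 => s us ss.
rewrite -mulr_sumr -mulrBr normrM (le_trans (ler_wpM2l _ (h0 _ us ss)))//.
by rewrite mulrCA ler_piMr ?(ltW e0)// ler_pdivrMr ?mul1r ?lerDl// ltr_wpDl.
Qed.

Lemma has_sum_eq f g S : f =1 g -> has_sum f S -> has_sum g S.
Proof. by move=> /funext ->. Qed.

Lemma has_sum1 f i : (forall j, j != i -> f j = 0) -> has_sum f (f i).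
Proof.
move=> fi e e0; exists [:: i] => s us /(_ i); rewrite inE eqxx => /(_ isT) si.
rewrite (bigD1_seq i)//= big1 ?addr0 ?subrr ?normr0 ?ltW//.
Qed.

Lemma abs_sum_le1 f i : (forall j, j != i -> f j = 0) -> abs_sum_le f `|f i|.
Proof.
move=> fi s us; have [si|si] := boolP (i \in s).
  rewrite (bigD1_seq i)//= big1 ?addr0// => j ji.
  by rewrite fi ?normr0.
rewrite big_seq big1 // => j js; rewrite fi ?normr0//.
by apply: contraNneq si => <-.
Qed.

Lemma abs_sum_tail f M e : abs_sum_le f M -> 0 < e -> exists s0, uniq s0 /\
  forall s, uniq s -> (forall i, i \in s -> i \notin s0) -> \sum_(i <- s) `|f i| <= e.
Proof.
move=> fM e0; pose A := [set x | exists2 s, uniq s & x = \sum_(i <- s) `|f i|].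
have A0 : has_sup A.
  split; first by exists 0; exists [::]; rewrite ?big_nil.
  by exists M => _ [s us ->]; exact: fM.
have [_ [s0 us0 ->] lt0] := sup_adherent e0 A0.
exists s0; split => // s us dis.
have : A (\sum_(i <- s0 ++ s) `|f i|).
  exists (s0 ++ s) => //; rewrite cat_uniq us0 us andbT; apply/hasPn => i.
  exact: dis.
by move=> /(ub_le_sup A0.2); rewrite big_cat/=; lra.
Qed.

Lemma has_sum_nneg f M : (forall i, 0 <= f i) -> abs_sum_le f M -> exists S, has_sum f S.
Proof.
move=> f0 fM; pose A := [set x | exists2 s, uniq s & x = \sum_(i <- s) f i].
have A0 : has_sup A.
  split; first by exists 0; exists [::]; rewrite ?big_nil.
  exists M => _ [s us ->]; apply: le_trans (fM s us).
  by apply: ler_sum => i _; exact: ler_norm.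
exists (sup A) => e e0; have [_ [s0 us0 ->] lt0] := sup_adherent e0 A0.
exists s0 => s us ss.
have h1 : \sum_(i <- s) f i <= sup A by apply: ub_le_sup; [exact: A0.2|exists s].
by have h2 := ler_sum_sub f0 us0 us ss; rewrite ger0_norm; lra.
Qed.

Lemma has_sum_exists f M : abs_sum_le f M -> exists S, has_sum f S.
Proof.
move=> fM.
have le1 (h : I -> R) : (forall i, `|h i| <= `|f i|) -> abs_sum_le h M.
  by move=> hf s us; apply: le_trans (fM s us); apply: ler_sum => i _.
have [||S1 h1] := @has_sum_nneg (fun i => Num.max (f i) 0) M.
- by move=> i; rewrite le_max lexx orbT.
- by apply: le1 => i; rewrite /Num.max; case: ifP => //; rewrite normr0.
have [||S2 h2] := @has_sum_nneg (fun i => Num.max (- f i) 0) M.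
- by move=> i; rewrite le_max lexx orbT.
- by apply: le1 => i; rewrite /Num.max; case: ifP => //; rewrite ?normr0 ?normrN.
exists (S1 + (-1) * S2); apply: has_sum_eq (has_sumD h1 (has_sumZ (-1) h2)) => i /=.
by rewrite /Num.max; case: ifP; case: ifP; lra.
Qed.

End one_family.

Section fubini.
Variables (I J : eqType) (F : I * J -> R) (r : I -> R) (M : R).
Hypotheses (FM : abs_sum_le F M) (Fr : forall i, has_sum (fun j => F (i, j)) (r i)).

Let rows (s : seq I) e : 0 < e -> exists K0 : seq J, forall K, uniq K -> {subset K0 <= K} ->
  \sum_(i <- s) `|r i - \sum_(j <- K) F (i, j)| <= e.
Proof.
elim: s e => [|i s IH] e e0.
  by exists [::] => K _ _; rewrite big_nil ltW.
have [K1 h1] := IH _ (divr_gt0 e0 (ltr0n _ 2)).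
have [K2 h2] := Fr i (divr_gt0 e0 (ltr0n _ 2)).
exists (K1 ++ K2) => K uK sK; rewrite big_cons [e](splitr e) lerD//.
  by apply: h2 => // j jK; apply: sK; rewrite mem_cat jK orbT.
by apply: h1 => // j jK; apply: sK; rewrite mem_cat jK.
Qed.

Lemma abs_sum_le_rows : abs_sum_le r M.
Proof.
move=> s us; apply/ler_addgt0Pr => e e0; have [K0 hK] := rows s e0.
pose K := undup K0; have {}hK : \sum_(i <- s) `|r i - \sum_(j <- K) F (i, j)| <= e.
  by apply: hK => [|j]; rewrite ?undup_uniq// mem_undup.
have uP : uniq [seq (i, j) | i <- s, j <- K].
  by apply: allpairs_uniq => //; rewrite ?undup_uniq// => -[? ?] [? ?].
have := FM uP; rewrite big_allpairs/= => hF.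
have : \sum_(i <- s) `|r i| <= \sum_(i <- s) `|r i - \sum_(j <- K) F (i, j)|
    + \sum_(i <- s) \sum_(j <- K) `|F (i, j)|.
  rewrite -big_split/=; apply: ler_sum => i _.
  rewrite -{1}(subrK (\sum_(j <- K) F (i, j)) (r i)) (le_trans (ler_normD _ _))// lerD2l.
  exact: ler_norm_sum.
by move=> h; apply: le_trans h _; lra.
Qed.

Let approx (s : seq I) (s0 : seq (I * J)) e : uniq s -> (forall p, p \in s0 -> p.1 \in s) ->
  0 < e -> exists D, [/\ uniq D, {subset s0 <= D} &
    `|\sum_(p <- D) F p - \sum_(i <- s) r i| <= e].
Proof.
move=> us ss0 e0; have [K0 hK] := rows s e0.
pose K := undup (K0 ++ map snd s0).
have uK : uniq K by exact: undup_uniq.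
exists [seq (i, j) | i <- s, j <- K]; split.
- by apply: allpairs_uniq => //; move=> -[? ?] [? ?].
- move=> [i j] ps; apply/allpairsP; exists (i, j); split => //; first exact: ss0 ps.
  by rewrite mem_undup mem_cat; apply/orP; right; apply/mapP; exists (i, j).
- rewrite big_allpairs/= distrC -sumrB (le_trans (ler_norm_sum _ _ _))//.
  by apply: hK => // j jK; rewrite mem_undup mem_cat jK.
Qed.

Lemma has_sum_pair S : has_sum r S -> has_sum F S.
Proof.
move=> rS e e0; have e3 : 0 < e / 3 by rewrite divr_gt0.
have [s0 [us0 tail]] := abs_sum_tail FM e3.
have [s1 h1] := rS _ e3; pose s := undup (s1 ++ map fst s0).
have us : uniq s by exact: undup_uniq.
have [|D [uD s0D hD]] := @approx s s0 (e / 3) us _ e3.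
  by move=> p ps; rewrite mem_undup mem_cat; apply/orP; right; apply/mapP; exists p.
have hs : `|S - \sum_(i <- s) r i| <= e / 3.
  by apply: h1 => // i is1; rewrite mem_undup mem_cat is1.
exists D => C uC DC; rewrite (perm_big _ (perm_sub uD uC DC))/= big_cat/=.
set t := [seq _ <- _ | _].
have ht : `|\sum_(p <- t) F p| <= e / 3.
  apply: le_trans (ler_norm_sum _ _ _) _; apply: tail; first exact: filter_uniq.
  by move=> p; rewrite mem_filter => /andP[pD _]; apply: contra pD => /s0D.
have -> : S - (\sum_(p <- D) F p + \sum_(p <- t) F p) = (S - \sum_(i <- s) r i) -
   (\sum_(p <- D) F p - \sum_(i <- s) r i) - \sum_(p <- t) F p by ring.
apply: le_trans (ler_normB _ _) _.
have := ler_normB (S - \sum_(i <- s) r i) (\sum_(p <- D) F p - \sum_(i <- s) r i).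
lra.
Qed.

Lemma has_sum_rows S : has_sum F S -> has_sum r S.
Proof.
move=> FS; have [S' rS'] := has_sum_exists abs_sum_le_rows.
by rewrite (has_sum_unique FS (has_sum_pair rS')).
Qed.

End fubini.

Lemma has_sum_swap (I J : eqType) (F : I * J -> R) S :
  has_sum F S -> has_sum (fun p : J * I => F (p.2, p.1)) S.
Proof.
move=> FS e e0; have [s0 h] := FS e e0.
have swap_inj (A B : Type) : injective (fun p : A * B => (p.2, p.1)).
  by move=> [? ?] [? ?] [-> ->].
exists [seq (p.2, p.1) | p <- s0] => s us ss.
have := h [seq (p.2, p.1) | p <- s]; rewrite big_map; apply.
  by rewrite map_inj_uniq//; exact: swap_inj.
move=> [i j] ps; apply/mapP; exists (j, i) => //; apply: ss.
by apply/mapP; exists (i, j).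
Qed.

Lemma abs_sum_le_swap (I J : eqType) (F : I * J -> R) M :
  abs_sum_le F M -> abs_sum_le (fun p : J * I => F (p.2, p.1)) M.
Proof.
move=> FM s us; have := FM [seq (p.2, p.1) | p <- s].
rewrite big_map; apply; rewrite map_inj_uniq// => -[? ?] [? ?] [-> ->] //.
Qed.

Lemma has_sum_series (f : nat -> R) M S : abs_sum_le f M ->
  series f n @[n --> \oo] --> S -> has_sum f S.
Proof.
move=> fM fS; have [S' fS'] := has_sum_exists fM.
suff -> : S = S' by [].
apply: (cvg_unique _ fS) => //; apply/cvgrPdist_le => e e0.
have [s0 h] := fS' _ e0; exists (\max_(i <- s0) i).+1 => // n /= sn.
rewrite /series/= -[in X in `|_ - X|]/(index_iota 0 n); apply: h; first exact: iota_uniq.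
move=> i is0; rewrite mem_index_iota/=; apply: leq_trans sn.
by rewrite ltnS; exact: leq_bigmax_seq.
Qed.

End unconditional_sums.
Section analytic_majorant.
Variables (R : realType) (d : nat).
Local Notation row := 'rV[R]_d.
Local Notation mindex := {ffun 'I_d -> nat}.
Implicit Types (y : row) (a b : mindex) (phi psi : row -> R).

Definition monomial a y : R := \prod_i y 0 i ^+ a i.

Definition in_cube y := forall i, `|y 0 i| <= 1.

Lemma monomial_le1 a y : in_cube y -> `|monomial a y| <= 1.
Proof.
move=> y1; rewrite /monomial normr_prod; apply: prodr_ile1 => i _.
by rewrite normr_ge0 normrX exprn_ile1 ?(y1 i).
Qed.

Definition l1_series phi M := exists2 c : mindex -> R, abs_sum_le c M &
  forall y, in_cube y -> has_sum (fun a => c a * monomial a y) (phi y).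

Lemma l1_series_regroup (I : eqType) (b : I -> R) (m : I -> mindex) phi M :
  abs_sum_le b M ->
  (forall y, in_cube y -> has_sum (fun i => b i * monomial (m i) y) (phi y)) ->
  l1_series phi M.
Proof.
move=> bM bphi; pose G (p : I * mindex) := if p.2 == m p.1 then b p.1 else 0.
have GM : abs_sum_le G M.
  move=> s us; pose s1 := undup (map fst s); pose s2 := undup (map snd s).
  apply: (@le_trans _ _ (\sum_(p <- [seq (i, a) | i <- s1, a <- s2]) `|G p|)).
    apply: ler_sum_sub => //.
      by apply: allpairs_uniq; rewrite ?undup_uniq// => -[? ?] [? ?].
    move=> [i a] ps; apply/allpairsP; exists (i, a); split => //; rewrite mem_undup;
      by apply/mapP; exists (i, a).
  rewrite big_allpairs/=; apply: le_trans (bM s1 (undup_uniq _)).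
  apply: ler_sum => i _; rewrite /G/=.
  have := @abs_sum_le1 R _ (fun a => if a == m i then b i else 0) (m i).
  rewrite eqxx; apply; last exact: undup_uniq.
  by move=> j /negbTE ->.
have rows a : {g | has_sum (fun i => G (i, a)) g}.
  apply/cid/(@has_sum_exists _ _ _ M) => s us.
  have := GM [seq (i, a) | i <- s]; rewrite big_map; apply.
  by rewrite map_inj_uniq// => ? ? [->].
pose c a := sval (rows a); have cG a : has_sum (fun i => G (i, a)) (c a) := svalP (rows a).
exists c; first exact: (abs_sum_le_rows (abs_sum_le_swap GM)).
move=> y y1.
pose Gy (p : I * mindex) := G p * monomial p.2 y.
have GyM : abs_sum_le Gy M.
  move=> s us; apply: le_trans (GM s us); apply: ler_sum => p _.
  by rewrite normrM ler_piMr// monomial_le1.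
apply: (has_sum_rows (abs_sum_le_swap GyM)).
  move=> a /=; rewrite mulrC; apply: has_sum_eq (has_sumZ (monomial a y) (cG a)) => i.
  by rewrite /Gy/= mulrC.
apply: has_sum_swap; apply: (has_sum_pair GyM) (bphi y y1) => i.
have := @has_sum1 R _ (fun a => Gy (i, a)) (m i).
rewrite /Gy /G/= eqxx; apply => a /negbTE ->.
by rewrite mul0r.
Qed.

Lemma l1_series_ext phi psi M : (forall y, in_cube y -> phi y = psi y) ->
  l1_series phi M -> l1_series psi M.
Proof. by move=> e [c cM cphi]; exists c => // y y1; rewrite -e//; exact: cphi. Qed.

Lemma l1_series_const k : l1_series (fun=> k) `|k|.
Proof.
pose c a := if a == [ffun=> 0%N] then k else 0.
exists c => [|y y1].
  have := @abs_sum_le1 R _ c [ffun=> 0%N]; rewrite /c eqxx; apply => a /negbTE.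
  by move=> ->.
have := @has_sum1 R _ (fun a => c a * monomial a y) [ffun=> 0%N].
rewrite /c eqxx /monomial big1 ?mulr1 => [|i _]; last by rewrite ffunE expr0.
by apply => a /negbTE ->; rewrite mul0r.
Qed.

Lemma l1_series_coord j : l1_series (fun y => y 0 j) 1.
Proof.
pose ej : mindex := [ffun i => nat_of_bool (i == j)].
pose c a : R := if a == ej then 1 else 0.
exists c => [|y y1].
  have := @abs_sum_le1 R _ c ej; rewrite /c eqxx normr1; apply => a /negbTE.
  by move=> ->.
have := @has_sum1 R _ (fun a => c a * monomial a y) ej.
have -> : c ej * monomial ej y = y 0 j.
  rewrite /c eqxx mul1r /monomial (bigD1 j)//= ffunE eqxx expr1 big1 ?mulr1// => i ij.
  by rewrite ffunE (negbTE ij) expr0.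
by apply => a ae; rewrite /c (negbTE ae) mul0r.
Qed.

Lemma l1_seriesD phi psi M M' : l1_series phi M -> l1_series psi M' ->
  l1_series (fun y => phi y + psi y) (M + M').
Proof.
move=> [c cM cphi] [c' cM' cpsi]; exists (fun a => c a + c' a) => [s us|y y1].
  apply: le_trans (lerD (cM s us) (cM' s us)); rewrite -big_split/=.
  by apply: ler_sum => a _; exact: ler_normD.
apply: has_sum_eq (has_sumD (cphi y y1) (cpsi y y1)) => a.
by rewrite mulrDl.
Qed.

Lemma l1_seriesZ k phi M : l1_series phi M -> l1_series (fun y => k * phi y) (`|k| * M).
Proof.
move=> [c cM cphi]; exists (fun a => k * c a) => [s us|y y1].
  rewrite (eq_bigr (fun a => `|k| * `|c a|)) => [|a _]; last by rewrite normrM.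
  by rewrite -mulr_sumr ler_wpM2l// cM.
by apply: has_sum_eq (has_sumZ k (cphi y y1)) => a; rewrite mulrA.
Qed.

Lemma l1_seriesM phi psi M M' : l1_series phi M -> l1_series psi M' ->
  l1_series (fun y => phi y * psi y) (M * M').
Proof.
move=> [c cM cphi] [c' cM' cpsi].
have cc : abs_sum_le (fun p : mindex * mindex => c p.1 * c' p.2) (M * M').
  move=> s us; pose s1 := undup (map fst s); pose s2 := undup (map snd s).
  apply: (@le_trans _ _ (\sum_(p <- [seq (i, a) | i <- s1, a <- s2]) `|c p.1 * c' p.2|)).
    apply: ler_sum_sub => //.
      by apply: allpairs_uniq; rewrite ?undup_uniq// => -[? ?] [? ?].
    move=> [i a] ps; apply/allpairsP; exists (i, a); split => //; rewrite mem_undup;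
      by apply/mapP; exists (i, a).
  rewrite big_allpairs/=.
  rewrite (eq_bigr (fun i => `|c i| * \sum_(a <- s2) `|c' a|)) => [|i _]; last first.
    by rewrite mulr_sumr; apply: eq_bigr => a _; rewrite normrM.
  rewrite -mulr_suml; apply: ler_pM; [exact: sumr_ge0|exact: sumr_ge0| |];
    [apply: cM|apply: cM']; exact: undup_uniq.
pose m (p : mindex * mindex) : mindex := [ffun i => (p.1 i + p.2 i)%N].
apply: (@l1_series_regroup _ _ m _ _ cc) => y y1.
have monoD p : monomial (m p) y = monomial p.1 y * monomial p.2 y.
  by rewrite /monomial -big_split/=; apply: eq_bigr => i _; rewrite ffunE exprD.
pose F (p : mindex * mindex) := c p.1 * c' p.2 * (monomial p.1 y * monomial p.2 y).
apply: (@has_sum_eq _ _ F) => [p|]; first by rewrite /F monoD.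
have FM : abs_sum_le F (M * M').
  move=> s us; apply: le_trans (cc s us); apply: ler_sum => p _.
  by rewrite /F normrM ler_piMr// normrM mulr_ile1// monomial_le1.
apply: (has_sum_pair FM (r := fun a => psi y * (c a * monomial a y))).
  move=> a; rewrite mulrC.
  apply: has_sum_eq (has_sumZ (c a * monomial a y) (cpsi y y1)) => b.
  by rewrite /F/=; ring.
by rewrite mulrC; apply: has_sumZ; exact: cphi.
Qed.

Lemma l1_seriesX phi M n : l1_series phi M -> l1_series (fun y => phi y ^+ n) (M ^+ n).
Proof.
move=> phiM; elim: n => [|n IH].
  by rewrite expr0 -(@normr1 R); apply: l1_series_ext (l1_series_const 1) => y; rewrite expr0.
rewrite exprS; apply: l1_series_ext (l1_seriesM phiM IH) => y _.
by rewrite exprS.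
Qed.

Lemma l1_series_sum (phi : nat -> row -> R) (M : nat -> R) psi L :
  (forall n, l1_series (phi n) (M n)) -> (forall k, \sum_(n <- iota 0 k) M n <= L) ->
  (forall y, in_cube y -> series (phi ^~ y) n @[n --> \oo] --> psi y) ->
  l1_series psi L.
Proof.
move=> phiM ML phipsi.
have cE n : {c : mindex -> R | abs_sum_le c (M n) /\
    forall y, in_cube y -> has_sum (fun a => c a * monomial a y) (phi n y)}.
  by apply: cid; have [c cM cphi] := phiM n; exists c.
pose c n := sval (cE n).
have cM n : abs_sum_le (c n) (M n) by have [] := svalP (cE n).
have cphi n y : in_cube y -> has_sum (fun a => c n a * monomial a y) (phi n y).
  by have [_] := svalP (cE n); apply.
have cL : abs_sum_le (fun p : nat * mindex => c p.1 p.2) L.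
  move=> s us; pose k := (\max_(p <- s) p.1).+1; pose s2 := undup (map snd s).
  apply: (@le_trans _ _ (\sum_(p <- [seq (i, a) | i <- iota 0 k, a <- s2]) `|c p.1 p.2|)).
    apply: ler_sum_sub => //.
      by apply: allpairs_uniq; rewrite ?undup_uniq// ?iota_uniq// => -[? ?] [? ?].
    move=> [i a] ps; apply/allpairsP; exists (i, a); split => //.
      rewrite mem_iota/= add0n ltnS.
      exact: (leq_bigmax_seq (F := fun p : nat * mindex => p.1)) ps _.
    by rewrite mem_undup; apply/mapP; exists (i, a).
  rewrite big_allpairs/=; apply: le_trans (ML k).
  by apply: ler_sum => n _; apply: cM; exact: undup_uniq.
apply: (l1_series_regroup (m := snd) cL) => y y1.
have FL : abs_sum_le (fun p : nat * mindex => c p.1 p.2 * monomial p.2 y) L.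
  move=> s us; apply: le_trans (cL s us); apply: ler_sum => p _.
  by rewrite normrM ler_piMr// monomial_le1.
have rowsF n := cphi n y y1.
apply: (has_sum_pair FL rowsF).
exact: has_sum_series (abs_sum_le_rows FL rowsF) (phipsi y y1).
Qed.

Lemma l1_series_ge0 phi M : l1_series phi M -> 0 <= M.
Proof. by move=> [c /abs_sum_le_ge0]. Qed.

Lemma l1_series_cos phi M : l1_series phi M -> l1_series (fun y => cos (phi y)) (expR M).
Proof.
move=> phiM; have M0 := l1_series_ge0 phiM.
pose k n : R := (~~ odd n)%:R * (-1) ^+ n./2 / n`!%:R.
apply: (@l1_series_sum (fun n y => k n * phi y ^+ n) (fun n => `|k n| * M ^+ n)).
- by move=> n; apply: l1_seriesZ; exact: l1_seriesX.
- move=> n; have expM : series (exp_coeff M) i @[i --> \oo] --> expR M.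
    exact: (@is_cvg_series_exp_coeff R M).
  apply: (@le_trans _ _ (series (exp_coeff M) n)); last first.
    rewrite -(cvg_lim _ expM)//; apply: nondecreasing_cvgn_le; last first.
      exact: is_cvg_series_exp_coeff.
    by apply: nondecreasing_series => i _ _; rewrite /exp_coeff/= divr_ge0// exprn_ge0.
  rewrite /series/= /index_iota subn0; apply: ler_sum => i _.
  rewrite /exp_coeff/= mulrC ler_wpM2l ?exprn_ge0// /k !normrM normrX normrN1 expr1n mulr1.
  rewrite normfV (ger0_norm (ler0n _ i`!)) ler_piMl ?invr_ge0//.
  by case: (odd i); rewrite ?normr0 ?normr1.
- move=> y y1; rewrite cos.unlock.
  have -> : series (fun n => k n * phi y ^+ n) = series (cos_coeff (phi y)).
    by rewrite cos_coeffE.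
  exact: (@is_cvg_series_cos_coeff R (phi y)).
Qed.

Lemma l1_series_teval (t : trig R d) (x : row) :
  exists M, l1_series (fun y => teval t (x + y)) M.
Proof.
elim: t => [a|s [M sM] t [M' tM]|s [M sM] t [M' tM]|k j s [M sM]].
- by exists `|a|; exact: l1_series_const.
- by exists (M + M'); exact: l1_seriesD sM tM.
- by exists (M * M'); exact: l1_seriesM sM tM.
- have := l1_series_cos (l1_seriesD (l1_seriesD (l1_series_const (2 * pi * k%:R * x 0 j))
    (l1_seriesZ (2 * pi * k%:R) (l1_series_coord j))) sM).
  move=> tM; eexists; apply: l1_series_ext tM => y _ /=.
  by rewrite mxE [2 * pi * k%:R * (_ + _)]mulrDr.
Qed.

Lemma teval_real_analytic (t : trig R d) : real_analytic (teval t).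
Proof.
move=> x; have [M [c cM tc]] := l1_series_teval t x.
exists 1; split => //; exists c => y y1.
have y1' : in_cube y by move=> i; exact/ltW/y1.
have F := @summability.totally_filter mindex; apply/cvgrPdist_le => e e0.
have [s0 h] := tc y y1' e e0.
exists [fset a in s0]%fset => // A /= s0A.
rewrite /summability.partial_sum -(big_seq_fsetE _ _ xpredT (fun a => c a * monomial a y))/=.
apply: h; first exact: fset_uniq.
by move=> a as0; apply: (fsubsetP s0A); rewrite !inE.
Qed.

End analytic_majorant.
(** * Holomorphic extension *)

Section complex_exp.
Variable R : realType.
Local Notation C := (complexF R).
Local Notation normc := (@Normc.normc R).
Implicit Types (a b : R) (z w : R[i]).

Lemma sin_lipschitz0 b : `|sin b| <= `|b|.
Proof.
wlog b0 : b / 0 <= b.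
  move=> H; case: (leP 0 b) => [/H//|b0]; rewrite -normrN -sinN -[leRHS]normrN.
  by apply: H; rewrite oppr_ge0 ltW.
have [|c _] := @MVT_segment R sin cos 0 b b0.
  by apply: continuous_subspaceT => x; exact: continuous_sin.
rewrite sin0 !subr0 => ->; rewrite normrM -[leRHS]mul1r.
by apply: ler_wpM2r => //; exact: cos_max.
Qed.

Lemma cos_sub1_le b : `|cos b - 1| <= b ^+ 2.
Proof.
wlog b0 : b / 0 <= b.
  move=> H; case: (leP 0 b) => [/H//|b0]; rewrite -cosN -sqrrN.
  by apply: H; rewrite oppr_ge0 ltW.
have [|c] := @MVT_segment R cos (fun x => - sin x) 0 b b0.
  by apply: continuous_subspaceT => x; exact: continuous_cos.
rewrite in_itv/= => /andP[c0 cb]; rewrite cos0 subr0 => ->.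
rewrite normrM normrN (ger0_norm b0) expr2 ler_wpM2r//.
by rewrite (le_trans (sin_lipschitz0 c))// ger0_norm.
Qed.

Lemma sin_sub_le b : `|b| <= 1 -> `|sin b - b| <= b ^+ 2.
Proof.
wlog b0 : b / 0 <= b.
  move=> H b1; case: (leP 0 b) => [/H->//|b0].
  have := H (- b); rewrite sinN normrN sqrrN -opprD normrN; apply => //.
  by rewrite oppr_ge0 ltW.
move=> b1; have [|c] := @MVT_segment R sin cos 0 b b0.
  by apply: continuous_subspaceT => x; exact: continuous_sin.
rewrite in_itv/= => /andP[c0 cb]; rewrite sin0 !subr0 => ->.
rewrite -[X in _ * b - X]mul1r -mulrBl normrM (ger0_norm b0) expr2 ler_wpM2r//.
apply: le_trans (cos_sub1_le c) _; rewrite expr2.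
move: b1; rewrite (ger0_norm b0) => b1; nra.
Qed.

Lemma expR_sub_le a : `|a| <= 1 / 2 -> 0 <= expR a - 1 - a <= 2 * a ^+ 2.
Proof.
rewrite ler_norml => /andP[a1 a2].
have h1 := expR_ge1Dx a; have h2 := expR_ge1Dx (- a).
have h3 : expR a * expR (- a) = 1 by rewrite -expRD subrr expR0.
have e0 := expR_gt0 a.
apply/andP; split; first lra.
have h4 : expR a * (1 - a) <= 1 by rewrite -[leRHS]h3 ler_pM2l.
have h5 : 0 <= a ^+ 2 * (1 - 2 * a) by rewrite mulr_ge0 ?sqr_ge0//; lra.
have h6 : (1 - a) * (1 + a + 2 * a ^+ 2) = 1 + a ^+ 2 * (1 - 2 * a) by ring.
suff : expR a <= 1 + a + 2 * a ^+ 2 by lra.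
rewrite -(@ler_pM2l _ (1 - a)); last lra.
by rewrite h6 mulrC; lra.
Qed.

Definition cexp (z : R[i]) : R[i] :=
  Complex (expR (complex.Re z) * cos (complex.Im z)) (expR (complex.Re z) * sin (complex.Im z)).

Lemma mulcE a b a' b' :
  Complex a b * Complex a' b' = Complex (a * a' - b * b') (a * b' + b * a').
Proof. by []. Qed.

Lemma cexpD z w : cexp (z + w) = cexp z * cexp w.
Proof.
case: z w => [a b] [a' b']; rewrite /cexp /=.
by rewrite mulcE expRD cosD sinD; congr Complex; ring.
Qed.

Lemma normc_cexp z : normc (cexp z) = expR (complex.Re z).
Proof.
by rewrite /cexp/= !exprMn -mulrDr cos2Dsin2 mulr1 sqrtr_sqr ger0_norm.
Qed.

Lemma normc_le a b : normc (Complex a b) <= `|a| + `|b|.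
Proof.
rewrite /= -[leRHS]ger0_norm ?addr_ge0// -sqrtr_sqr ler_sqrt ?sqr_ge0//.
rewrite -(real_normK (num_real a)) -(real_normK (num_real b)).
have := normr_ge0 a; have := normr_ge0 b; nra.
Qed.

Lemma Re_le_normc z : `|complex.Re z| <= normc z.
Proof.
by case: z => [a b] /=; rewrite -sqrtr_sqr ler_sqrt ?addr_ge0 ?sqr_ge0// lerDl sqr_ge0.
Qed.

Lemma Im_le_normc z : `|complex.Im z| <= normc z.
Proof.
by case: z => [a b] /=; rewrite -sqrtr_sqr ler_sqrt ?addr_ge0 ?sqr_ge0// lerDr sqr_ge0.
Qed.

Lemma cexp_sub_le z : normc z <= 1 / 2 -> normc (cexp z - 1 - z) <= 8 * normc z ^+ 2.
Proof.
move=> z1; have hR := le_trans (Re_le_normc z) z1; have hI := le_trans (Im_le_normc z) z1.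
have zE : normc z ^+ 2 = complex.Re z ^+ 2 + complex.Im z ^+ 2.
  by case: (z) => a b /=; rewrite sqr_sqrtr// addr_ge0// sqr_ge0.
rewrite zE; move: hR hI {zE z1}; case: z => a b /= ha hb.
apply: le_trans (normc_le _ _) _; rewrite /= subr0.
have /andP[e1 e2] := expR_sub_le ha; have c1 := cos_sub1_le b.
have s1 : `|sin b - b| <= b ^+ 2 by apply: sin_sub_le; lra.
have a2 : a ^+ 2 <= `|a| / 2.
  by rewrite -(real_normK (num_real a)) expr2; have := normr_ge0 a; nra.
have ea2 : 0 < expR a <= 2.
  rewrite expR_gt0/=; move: (ha); rewrite ler_norml => /andP[_]; lra.
case/andP: ea2 => ea0 ea2.
have -> : expR a * cos b - 1 - a = (expR a - 1 - a) + expR a * (cos b - 1) by ring.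
have -> : expR a * sin b - b = (expR a - 1) * sin b + (sin b - b) by ring.
have t1 : `|(expR a - 1 - a) + expR a * (cos b - 1)| <= 2 * a ^+ 2 + 2 * b ^+ 2.
  apply: le_trans (ler_normD _ _) _; apply: lerD; first by rewrite ger0_norm.
  by rewrite normrM (gtr0_norm ea0); apply: ler_pM => //; exact: ltW.
have t2 : `|(expR a - 1) * sin b| <= 2 * `|a| * `|b|.
  rewrite normrM; apply: ler_pM => //; last exact: sin_lipschitz0.
  have -> : expR a - 1 = (expR a - 1 - a) + a by ring.
  apply: le_trans (ler_normD _ _) _; rewrite (ger0_norm e1); lra.
have t3 : `|(expR a - 1) * sin b + (sin b - b)| <= 2 * `|a| * `|b| + b ^+ 2.
  by apply: le_trans (ler_normD _ _) _; exact: lerD.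
have t4 : 2 * `|a| * `|b| <= a ^+ 2 + b ^+ 2.
  rewrite -(real_normK (num_real a)) -(real_normK (num_real b)).
  have := sqr_ge0 (`|a| - `|b|); rewrite !expr2; nra.
have := sqr_ge0 a; have := sqr_ge0 b; lra.
Qed.

Lemma normCE (z : C) : `|z| = (normc z)%:C%C.
Proof. by []. Qed.

Lemma cexp_derivable (w : C) : derivable (cexp : C -> C^o) w 1.
Proof.
rewrite /derivable; apply: (cvgP (cexp w : C^o)).
apply/cvgrPdist_le => e e0.
have eE : e = (complex.Re e)%:C%C by rewrite RRe_real// gtr0_real.
have re0 : 0 < complex.Re e by rewrite -ltcR -eE.
pose K := 8 * normc (cexp w) + 1.
have K0 : 0 < K by rewrite /K normc_cexp ltr_wpDl// mulr_ge0// expR_ge0.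
pose r := Num.min (1 / 2) (complex.Re e / K).
have r0 : 0 < r by rewrite lt_min divr_gt0// divr_gt0.
have r0C : (0 : C) < r%:C%C by rewrite (ltcR 0 r).
near=> h.
have h0 : h != 0 by near: h; exact: nbhs_dnbhs_neq.
have hr : normc h <= r.
  have : `|0 - h : C^o| <= r%:C%C.
    by near: h; apply: (@cvgr_dist_le _ _ _ (0^') _ id 0 _ _ r0C); exact: nbhs_dnbhs.
  by rewrite sub0r normrN normCE lecR.
have [h2 hK] : normc h <= 1 / 2 /\ normc h <= complex.Re e / K.
  by split; apply: (le_trans hr); rewrite /r ge_min lexx ?orbT.
have nh0 : 0 < normc h.
  rewrite lt_def; apply/andP; split; last exact: le_trans (normr_ge0 _) (Re_le_normc h).
  by apply: contraNneq h0 => /Normc.eq0_normc ->.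
have -> : cexp w - h^-1 *: ((cexp (h *: 1 + w) : C^o) - cexp w) =
    - (cexp w * (h^-1 * (cexp h - 1 - h))).
  rewrite (_ : h *: 1 = h) ?cexpD; last by rewrite -[LHS]/(h * 1) mulr1.
  rewrite -[_ *: _]/(h^-1 * _).
  by field.
rewrite normrN normCE eE lecR !Normc.normcM Normc.normcV.
have := cexp_sub_le h2; set X := normc (cexp h - 1 - h) => hX.
have : normc (cexp w) * ((normc h)^-1 * X) <= normc (cexp w) * (8 * normc h).
  rewrite ler_wpM2l ?normc_cexp ?expR_ge0// mulrC ler_pdivrMr//.
  by rewrite -mulrA -expr2.
move=> h4; apply: le_trans h4 _.
have hK' : K * normc h <= complex.Re e by rewrite mulrC -ler_pdivlMr.
apply: le_trans hK'; rewrite /K.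
have -> : (8 * normc (cexp w) + 1) * normc h =
  normc (cexp w) * (8 * normc h) + normc h by ring.
by rewrite lerDl; exact: ltW.
Unshelve. all: by end_near.
Qed.

Lemma cexp_differentiable (w : C) : differentiable (cexp : C -> C^o) w.
Proof. by apply/derivable1_diffP; exact: cexp_derivable. Qed.

End complex_exp.
Section complex_extension.
Variables (R : realType) (d : nat).
Local Notation C := (complexF R).
Local Notation normc := (@Normc.normc R).

Definition ccos (w : C) : C := 2^-1 * (cexp (Complex 0 1 * w) + cexp (- (Complex 0 1 * w))).

Fixpoint tevalC (t : trig R d) (z : 'rV[C]_d) : C :=
  match t with
  | TConst a => a%:C%C
  | TAdd s t => tevalC s z + tevalC t z
  | TMul s t => tevalC s z * tevalC t z
  | TCos k j s => ccos ((2 * pi * k%:R : R)%:C%C * z 0 j + tevalC s z)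
  end.

Lemma tevalC_differentiable t (z : 'rV[C]_d) : differentiable (tevalC t : _ -> C^o) z.
Proof.
have dM (f g : 'rV[C]_d -> C) : differentiable (f : _ -> C^o) z ->
    differentiable (g : _ -> C^o) z -> differentiable ((fun z => f z * g z) : _ -> C^o) z.
  exact: differentiableM.
have dD (f g : 'rV[C]_d -> C) : differentiable (f : _ -> C^o) z ->
    differentiable (g : _ -> C^o) z -> differentiable ((fun z => f z + g z) : _ -> C^o) z.
  exact: differentiableD.
have dK (c : C) : differentiable ((fun=> c) : 'rV[C]_d -> C^o) z.
  exact: differentiable_cst.
have dE (f : 'rV[C]_d -> C) : differentiable (f : _ -> C^o) z ->
    differentiable ((fun z => cexp (f z)) : _ -> C^o) z.
  by move=> df; apply: (differentiable_comp df); exact: cexp_differentiable.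
elim: t => [a|s IHs t IHt|s IHs t IHt|k j s IHs] /=.
- exact: dK.
- exact: dD.
- exact: dM.
- have dw : differentiable ((fun z : 'rV[C]_d =>
      (2 * pi * k%:R : R)%:C%C * z 0 j + tevalC s z : C) : _ -> C^o) z.
    by apply: (dD _ _ _ _) => //; apply: (dM _ _ _ _) => //; exact: differentiable_coord.
  apply: (dM _ _ _ _) => //; apply: (dD _ _ _ _); apply: (dE _ _); first exact: dM.
  by apply: differentiableN; exact: dM.
Qed.

Lemma real_complexM (a b : R) : (a * b)%:C%C = a%:C%C * b%:C%C :> C.
Proof. exact: rmorphM. Qed.

Lemma real_complexD (a b : R) : (a + b)%:C%C = a%:C%C + b%:C%C :> C.
Proof. exact: rmorphD. Qed.

Lemma ccos_real (a : R) : ccos (a%:C%C) = (cos a)%:C%C.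
Proof.
rewrite /ccos /cexp /real_complex_def.
have -> : Complex 0 1 * Complex a 0 = Complex 0 a :> C.
  by rewrite mulcE; congr Complex; ring.
rewrite /= oppr0 !expR0 !mul1r cosN sinN.
have -> : (2^-1 : C) = (2^-1 : R)%:C%C by rewrite fmorphV rmorph_nat.
rewrite /real_complex_def -[Complex (cos a) _ + _]/(Complex (cos a + cos a) (sin a - sin a)).
by rewrite mulcE; congr Complex; rewrite ?subrr; field.
Qed.

Lemma tevalC_real t (x : 'rV[R]_d) :
  tevalC t (map_mx (real_complex R) x) = (teval t x)%:C%C.
Proof.
elim: t => [a|s IHs t IHt|s IHs t IHt|k j s IHs] //=; rewrite ?IHs ?IHt.
- by rewrite real_complexD.
- by rewrite real_complexM.
by rewrite mxE -ccos_real !real_complexD !real_complexM.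
Qed.

Lemma normcD_le (z w : C) : normc (z + w) <= normc z + normc w.
Proof. by have := ler_normD z w; rewrite !normCE -real_complexD lecR. Qed.

Lemma ccos_bounded (w : C) B : `|complex.Im w| <= B -> normc (ccos w) <= expR B.
Proof.
rewrite ler_norml => /andP[B1 B2]; rewrite /ccos Normc.normcM.
have -> : normc 2^-1 = 2^-1 :> R.
  have -> : (2^-1 : C) = (2^-1 : R)%:C%C by rewrite fmorphV rmorph_nat.
  by rewrite /= expr0n/= addr0 sqrtr_sqr ger0_norm.
rewrite ler_pdivrMl//; apply: le_trans (normcD_le _ _) _.
rewrite !normc_cexp [leRHS]mulr_natl mulr2n; apply: lerD; rewrite ler_expR;
  case: w B1 B2 => u v /= B1 B2; lra.
Qed.

Lemma tevalC_bounded t (rho : R) :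
  exists M, forall z, strip rho z -> normc (tevalC t z) <= M.
Proof.
elim: t => [a|s [M sM] t [M' tM]|s [M sM] t [M' tM]|k j s [M sM]] /=.
- by exists (normc (a%:C%C)).
- exists (M + M') => z zr; apply: le_trans (normcD_le _ _) _.
  by apply: lerD; [exact: sM|exact: tM].
- exists (M * M') => z zr; rewrite Normc.normcM.
  have n0 (w : C) : 0 <= normc w by apply: le_trans (normr_ge0 _) (Re_le_normc w).
  by apply: ler_pM; rewrite ?n0//; [exact: sM|exact: tM].
- exists (expR (2 * pi * k%:R * rho + M)) => z zr; apply: ccos_bounded.
  have k0 : 0 <= 2 * pi * k%:R :> R by rewrite !mulr_ge0// pi_ge0.
  have sI := le_trans (Im_le_normc _) (sM z zr).
  have zI := zr j; rewrite /tevalC -/tevalC.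
  move: sI zI; case: (tevalC s z) => u v; case: (z 0 j) => u' v' /=.
  move=> vM v'r; rewrite mul0r addr0.
  apply: le_trans (ler_normD _ _) _; apply: lerD => //.
  by rewrite normrM (ger0_norm k0) ler_wpM2l// ltW.
Qed.

Lemma teval_Comega t (rho : R) : Comega rho (@teval R d t).
Proof.
split; [exact: teval_periodic|exact: teval_real_analytic|].
exists (tevalC t); split.
- by move=> z _; exact: tevalC_differentiable.
- by move=> x; exact: tevalC_real.
- exact: tevalC_bounded.
Qed.

End complex_extension.
(** * Analytic diffeomorphisms *)

Section homotopy.
Variables (R : realType) (d : nat).
Local Notation torus := (torus R d).
Local Notation row := 'rV[R]_d.

Lemma proj_continuous : continuous (@proj R d : row -> torus).
Proof. exact: pi_continuous. Qed.

Lemma proj_open (v : row) (A : set row) : nbhs v A -> nbhs (proj v) (@proj R d @` A : set torus).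
Proof.
rewrite nbhsE => -[U [oU Uv] UA]; rewrite nbhsE; exists (@proj R d @` U).
  split; last by exists v.
  rewrite /open/= /quotient_open/=.
  rewrite (_ : _ @^-1` _ = \bigcup_(k in [set k | k \in @integer_vector R d])
      ((fun w : row => w + k) @^-1` U)).
    apply: bigcup_open => k _.
    apply: (@open_comp row row (fun w => w + k) U _ oU) => w _.
    by have FF := nbhs_filter (w : row); apply: cvgD; [exact: cvg_id|exact: cvg_cst].
  apply/seteqP; split => w /=.
    move=> [u Uu] /proj_eq uw; exists (u - w) => //=.
    by rewrite subrKC.
  by move=> [k /= kZ Uwk]; exists (w + k) => //; exact: proj_int.
by move=> _ [u Uu <-]; exists u => //; exact: UA.
Qed.

Lemma shift_homotopic_to_id (f : 'I_d -> row -> R) (h : torus -> torus) :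
  (forall i, Defs.periodic (f i)) -> (forall i, continuous (f i)) ->
  is_lift h (shift_by f) -> homotopic_to_id h.
Proof.
move=> pf cf hf; pose F (v : row) := \sum_i f i v *: unit_row R i.
have FE v : v + F v = shift_by f v.
  apply/rowP => j; rewrite !mxE summxE (bigD1 j)//= big1 => [|i ij].
    by rewrite unit_rowE eqxx addr0.
  by rewrite unit_rowE eq_sym (negbTE ij).
have cF : continuous F.
  have cS s : continuous (fun w : row => \sum_(i <- s) f i w *: unit_row R i).
    elim: s => [|i s IH].
      rewrite (_ : (fun w => _) = (fun=> 0 : row)); first last.
        by apply/funext => w; rewrite big_nil.
      by move=> w; have FF := nbhs_filter (w : row); exact: cvg_cst.
    rewrite (_ : (fun w => _) =
        (fun w => f i w *: unit_row R i + \sum_(j <- s) f j w *: unit_row R j)).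
      move=> w; have FF := nbhs_filter (w : row).
      by apply: cvgD; [apply: cvgZr_tmp; exact: cf|exact: IH].
    by apply/funext => w; rewrite big_cons.
  exact: cS.
have pF v k : k \in @integer_vector R d -> F (v + k) = F v.
  by move=> kZ; apply: eq_bigr => i _; rewrite pf.
pose H (p : R * torus) := p.2 + proj (p.1 *: F (repr p.2)).
have HE t v : H (t, proj v) = proj (v + t *: F v).
  rewrite /H/= projD; congr (_ + proj (_ *: _)).
  have : repr (proj v) - v \in @integer_vector R d by apply/proj_eq; rewrite proj_repr.
  by move=> /(pF v) <-; rewrite subrKC.
exists H; split.
- apply: continuous_subspaceT => -[t x]; have [v ->] := torusP x.
  move=> W; rewrite HE => nW.
  have cG : continuous (fun p : R * row => proj (p.2 + p.1 *: F p.2) : torus).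
    move=> [s w]; have FF := nbhs_filter ((s, w) : R * row).
    apply: (@continuous_comp _ _ _ (fun p : R * row => p.2 + p.1 *: F p.2)).
      apply: cvgD; first exact: cvg_snd.
      apply: cvgZ; first exact: cvg_fst.
      by apply: (@continuous_comp _ _ _ snd F); [exact: cvg_snd|exact: cF].
    exact: proj_continuous.
  have [[A B] /= [nA nB] AB] := cG (t, v) W nW.
  exists (A, @proj R d @` B) => /=; first by split => //; exact: proj_open.
  move=> [s y] [/= As [w Bw <-]]; rewrite /= HE.
  exact: (AB (s, w)).
- by move=> x; rewrite /H/= scale0r proj0 addr0.
- by move=> x; have [v ->] := torusP x; rewrite HE scale1r FE; exact/esym/hf.
Qed.

End homotopy.

Section trig_diffeo.
Variables (R : realType) (d : nat).
Local Notation torus := (torus R d).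
Local Notation row := 'rV[R]_d.
Implicit Types (g h : torus -> torus) (a b : 'I_d -> trig R d) (x y : torus).

Definition trig_lift h a := is_lift h (shift_by (fun i => teval (a i))).

Definition trig_diffeo h := measure_preserving h /\
  exists g a b, [/\ cancel h g /\ cancel g h, trig_lift h a & trig_lift g b].

Lemma trig_diffeo_Diff_omega h : trig_diffeo h -> Diff_omega_infty h.
Proof.
move=> [mh [g [a [b [hg ha gb]]]]] n _; split => //.
  apply: (shift_homotopic_to_id _ _ ha) => i; first exact: teval_periodic.
  exact: teval_continuous.
exists g, (fun i => teval (a i)), (fun i => teval (b i)).
by split => // i; exact: teval_Comega.
Qed.

Lemma trig_diffeo_id : trig_diffeo id.
Proof.
split; first exact: measure_preserving_id.
have lid : trig_lift id (fun=> TConst d 0).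
  by move=> v; congr proj; apply/rowP => j; rewrite !mxE /= addr0.
by exists id, (fun=> TConst d 0), (fun=> TConst d 0).
Qed.

Definition trig_comp a b : 'I_d -> trig R d := fun i => TAdd (b i) (tsubst b (a i)).

Lemma trig_lift_comp h g a b : trig_lift h a -> trig_lift g b ->
  trig_lift (h \o g) (trig_comp a b).
Proof.
move=> ha gb v; rewrite /= gb ha; congr proj; apply/rowP => j.
by rewrite !mxE /= teval_subst addrA.
Qed.

Lemma trig_diffeo_comp h h' : trig_diffeo h -> trig_diffeo h' -> trig_diffeo (h \o h').
Proof.
move=> [mh [g [a [b [[hg gh] ha gb]]]]] [mh' [g' [a' [b' [[hg' gh'] ha' gb']]]]].
split; first exact: measure_preserving_comp.
exists (g' \o g), (trig_comp a a'), (trig_comp b' b); split.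
- by split; exact: can_comp.
- exact: trig_lift_comp.
- exact: trig_lift_comp.
Qed.

Definition tfun (t : trig R d) x := teval t (repr x).

Lemma tfun_proj t v : tfun t (proj v) = teval t v.
Proof.
have : repr (proj v) - v \in @integer_vector R d by apply/proj_eq; rewrite proj_repr.
by move=> /(@teval_periodic _ _ t v) <-; rewrite subrKC.
Qed.

Lemma measurable_tfun t : measurable_fun setT (tfun t).
Proof.
apply: measurable_torus_fun; rewrite (_ : _ \o _ = fun u => teval t (tuple_row u)).
  exact: teval_measurable.
by apply/funext => u; rewrite /= tfun_proj.
Qed.

Lemma trig_diffeo_shear i t : (forall v c, teval t (v + c *: unit_row R i) = teval t v) ->
  trig_diffeo (shear i (tfun t)).
Proof.
move=> ti.
have tfi x c : tfun t (x + proj (c *: unit_row R i)) = tfun t x.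
  by have [v ->] := torusP x; rewrite -projD !tfun_proj ti.
split; first by apply: shear_measure_preserving; [exact: measurable_tfun|].
pose tN := TMul (TConst d (-1)) t.
have lift s : trig_lift (shear i (tfun s)) (fun j => if j == i then s else TConst d 0).
  move=> v; rewrite /shear -/(proj v) tfun_proj -projD; congr proj; apply/rowP => j.
  by rewrite mxE unit_rowE [RHS]mxE; case: (j == i).
have tNE x : tfun tN x = - tfun t x by rewrite /tfun/= mulN1r.
exists (shear i (tfun tN)), (fun j => if j == i then t else TConst d 0),
  (fun j => if j == i then tN else TConst d 0); split => //.
by split=> x; rewrite /shear tNE ?tNE tfi ?tNE -addrA -projD -scalerDl
  ?subrr ?addNr scale0r proj0 addr0.
Qed.

Definition close (e : R) x y := exists2 v, y = x + proj v & forall j, `|v 0 j| <= e.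

Lemma close_trans e e' x y z : close e x y -> close e' y z -> close (e + e') x z.
Proof.
move=> [v -> ve] [w -> we']; exists (v + w); first by rewrite projD addrA.
by move=> j; rewrite mxE (le_trans (ler_normD _ _))// lerD.
Qed.

Lemma close_sym e x y : close e x y -> close e y x.
Proof.
move=> [v -> ve]; exists (- v); first by rewrite projN addrK.
by move=> j; rewrite mxE normrN.
Qed.

Lemma closeW e e' x y : e <= e' -> close e x y -> close e' x y.
Proof. by move=> ee' [v xy ve]; exists v => // j; exact: le_trans ee'. Qed.

Lemma close_refl x : close 0 x x.
Proof. by exists 0 => [|j]; rewrite ?proj0 ?addr0// mxE normr0. Qed.

Lemma torus_dist_close e x y : 0 <= e -> close e x y ->
  torus_dist x y <= Num.sqrt d%:R * e.
Proof.
move=> e0 /close_sym[v xy ve].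
have lb : has_lbound [set Num.sqrt (\sum_i v 0 i ^+ 2) | v in
    [set v : row | \pi_torus v = x - y]].
  by exists 0 => _ [w _ <-]; exact: sqrtr_ge0.
apply: (@le_trans _ _ (Num.sqrt (\sum_i v 0 i ^+ 2))).
  by apply: ge_inf => //; exists v => //; rewrite /= xy addrC addKr.
rewrite -(ger0_norm e0) -sqrtr_sqr -sqrtrM ?ler0n// ler_sqrt; last first.
  by rewrite mulr_ge0 ?sqr_ge0.
rewrite mulr_natl -[X in _ *+ X]card_ord -sumr_const; apply: ler_sum => i _.
by rewrite -real_normK ?num_real// ler_sqr ?nnegrE// ger0_norm.
Qed.

Lemma trig_lift_lipschitz h a : trig_lift h a ->
  exists2 L, 0 <= L & forall x y e, close e x y -> close (L * e) (h x) (h y).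
Proof.
move=> ha.
have [L L0 aL] : exists2 L, 0 <= L & forall i (v w : row) e,
    (forall j, `|v 0 j - w 0 j| <= e) -> `|teval (a i) v - teval (a i) w| <= L * e.
  have LL i : {L | 0 <= L & forall (v w : row) e,
      (forall j, `|v 0 j - w 0 j| <= e) -> `|teval (a i) v - teval (a i) w| <= L * e}.
    by apply: cid2; exact: teval_lipschitz.
  exists (\sum_i s2val (LL i)) => [|i v w e vw].
    by apply: sumr_ge0 => i _; case: (LL i).
  have e0 : 0 <= e by apply: le_trans (normr_ge0 _) (vw i).
  apply: le_trans (s2valP' (LL i) v w e vw) _; rewrite ler_wpM2r//.
  rewrite (bigD1 i)//= lerDl; apply: sumr_ge0 => j _.
  by case: (LL j).
exists (1 + L) => [|x y e [v -> ve]]; first exact: addr_ge0.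
have [u ->] := torusP x; rewrite -projD !ha.
exists (shift_by (fun i => teval (a i)) (u + v) - shift_by (fun i => teval (a i)) u).
  by rewrite -projD subrKC.
move=> j; rewrite !mxE opprD addrACA [u 0 j + _]addrC addrK mulrDl mul1r.
apply: le_trans (ler_normD _ _) _; apply: lerD => //.
by apply: aL => k; rewrite mxE [u 0 k + _]addrC addrK.
Qed.

End trig_diffeo.
(** * Approximation of line shifts *)

Section step_approximation.
Variable R : realType.
Implicit Types (r x y : R).

Lemma lt_cos x y : 0 <= x -> x < y -> y <= pi -> cos y < cos x.
Proof.
move=> x0 xy yp; have x1 : x <= pi by rewrite (le_trans (ltW xy)).
have y0 : 0 <= y by rewrite (le_trans x0)// ltW.
by rewrite ltr_cos// in_itv/= ?x0 ?y0.
Qed.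

Lemma cos_above (m : nat) r : (0 < m)%N -> 0 < r < 1 ->
  cos (pi / m%:R) < cos (2 * pi * (r - 2^-1) / m%:R) :> R.
Proof.
move=> m0 /andP[r0 r1]; have pi0 := @pi_gt0 R.
have m1 : 1 <= m%:R :> R by rewrite ler1n.
have mR : 0 < m%:R :> R by rewrite ltr0n.
have -> : 2 * pi * (r - 2^-1) / m%:R = (2 * r - 1) * (pi / m%:R) :> R by field; lra.
have pm : 0 < pi / m%:R :> R by rewrite divr_gt0.
have pm1 : pi / m%:R <= pi :> R by rewrite ler_pdivrMr// ler_peMr// ltW.
set b := (2 * r - 1).
have -> : cos (b * (pi / m%:R)) = cos (`|b| * (pi / m%:R)).
  by case: (ger0P b) => // _; rewrite mulNr cosN.
have b1 : `|b| < 1 by rewrite ltr_norml /b; apply/andP; split; lra.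
have bp : `|b| * (pi / m%:R) < pi / m%:R :> R by rewrite gtr_pMl.
by apply: lt_cos => //; rewrite mulr_ge0// ltW.
Qed.

Lemma cos_below (m : nat) r : 1 < r < m%:R ->
  cos (2 * pi * (r - 2^-1) / m%:R) < cos (pi / m%:R) :> R.
Proof.
move=> /andP[r1 rm]; have pi0 := @pi_gt0 R.
have mR : 0 < m%:R :> R by lra.
have m1 : 1 < m%:R :> R by lra.
pose c : R := pi / m%:R.
have cm : c * m%:R = pi by rewrite /c divfK// lt0r_neq0.
have c0 : 0 < c by rewrite /c divr_gt0.
have -> : 2 * pi * (r - 2^-1) / m%:R = (2 * r - 1) * c :> R by rewrite /c; field; lra.
rewrite -/c; set b := (2 * r - 1) * c.
have cb : c < b by rewrite /b ltr_pMl//; lra.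
have b2 : b < 2 * pi - c by rewrite /b -cm; nra.
have [bp|bp] := leP b pi.
  by apply: lt_cos => //; exact: ltW.
have -> : cos b = cos (2 * pi - b).
  by rewrite -cosN -(cosD2piz _ 1); congr (cos _); ring.
by apply: lt_cos; lra.
Qed.

Lemma bernoulli_le y k : 0 <= y <= 1 -> 1 - k%:R * y <= (1 - y) ^+ k.
Proof.
move=> /andP[y0 y1]; elim: k => [|k IH]; first by rewrite mul0r subr0 expr0.
rewrite exprS -natr1.
have h : (1 - y) * (1 - k%:R * y) <= (1 - y) * (1 - y) ^+ k by rewrite ler_wpM2l// subr_ge0.
apply: le_trans h; have : 0 <= k%:R * y * y :> R by rewrite !mulr_ge0.
lra.
Qed.

Lemma expr_sub1_le y k : 0 < y <= 1 -> (1 - y) ^+ k * (1 + k%:R * y) <= 1.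
Proof.
move=> /andP[y0 y1]; have y0' := ltW y0.
have h : 1 + k%:R * y <= (1 + y) ^+ k.
  elim: k => [|k IH]; first by rewrite mul0r addr0 expr0.
  rewrite exprS -natr1.
  have h : (1 + y) * (1 + k%:R * y) <= (1 + y) * (1 + y) ^+ k.
    by rewrite ler_wpM2l// addr_ge0.
  apply: le_trans h; have : 0 <= k%:R * y * y :> R by rewrite !mulr_ge0.
  lra.
have h1 : 0 <= 1 - y by rewrite subr_ge0.
apply: (@le_trans _ _ ((1 - y) ^+ k * (1 + y) ^+ k)).
  by rewrite ler_wpM2l// exprn_ge0.
rewrite -exprMn exprn_ile1//; first by rewrite mulr_ge0// addr_ge0.
have : 0 <= y * y by rewrite mulr_ge0.
lra.
Qed.

(* switches from 1 to 0 at x = 1/2 as n grows *)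
Definition bump (n : nat) x := (1 - x ^+ n) ^+ (2 ^ n).

Lemma bump_cvg1 x : 0 <= x < 2^-1 -> bump n x @[n --> \oo] --> (1 : R).
Proof.
move=> /andP[x0 x2]; have x1 : x <= 1 by lra.
have xn n : 0 <= x ^+ n <= 1 by rewrite exprn_ge0//= exprn_ile1.
apply: (@squeeze_cvgr _ _ _ _ (fun n => 1 - (2 * x) ^+ n) (fun=> 1)).
- near=> n; apply/andP; split.
    apply: le_trans (bernoulli_le (2 ^ n) (xn n)).
    by rewrite exprMn natrX.
  have /andP[h1 h2] := xn n.
  by rewrite /bump exprn_ile1// ?subr_ge0// gerBl.
- rewrite -[X in _ --> X]subr0; apply: cvgB; first exact: cvg_cst.
  by apply: cvg_expr; rewrite ger0_norm; lra.
- exact: cvg_cst.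
Unshelve. all: by end_near.
Qed.

Lemma bump_cvg0 x : 2^-1 < x <= 1 -> bump n x @[n --> \oo] --> (0 : R).
Proof.
move=> /andP[x2 x1]; have x0 : 0 < x by lra.
have xn n : 0 < x ^+ n <= 1 by rewrite exprn_gt0//= exprn_ile1// ltW.
apply: (@squeeze_cvgr _ _ _ _ (fun=> 0) (fun n => ((2 * x)^-1) ^+ n)).
- near=> n; have /andP[h1 h2] := xn n; apply/andP; split.
    by rewrite /bump exprn_ge0// subr_ge0.
  have h := expr_sub1_le (2 ^ n) (xn n).
  have b0 : 0 <= bump n x by rewrite /bump exprn_ge0// subr_ge0.
  have p0 : 0 < (2 * x) ^+ n by rewrite exprn_gt0//; lra.
  rewrite exprVn -[_^-1]mul1r ler_pdivlMr//; apply: le_trans h.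
  by rewrite -/(bump n x) ler_wpM2l// exprMn natrX lerDr.
- exact: cvg_cst.
- apply: cvg_expr; rewrite ger0_norm ?invr_ge0; last lra.
  by rewrite invf_lt1; lra.
Unshelve. all: by end_near.
Qed.

Lemma cvg_prod_seq (I : Type) (s : seq I) (f : I -> nat -> R) (l : I -> R) :
  (forall i, f i n @[n --> \oo] --> l i) ->
  \prod_(i <- s) f i n @[n --> \oo] --> \prod_(i <- s) l i.
Proof.
move=> fl; elim: s => [|i s IH].
  rewrite big_nil (_ : (fun n => _) = (fun=> 1)); first exact: cvg_cst.
  by apply/funext => n; rewrite big_nil.
rewrite big_cons (_ : (fun n => _) = (fun n => f i n * \prod_(j <- s) f j n)).
  exact: cvgM.
by apply/funext => n; rewrite big_cons.
Qed.

End step_approximation.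
Section line_indicator.
Variables (R : realType) (q M n : nat).
Hypotheses (q_gt0 : (0 < q)%N) (M_gt1 : (1 < M)%N).
Let N := (q * M)%N.
Local Notation torus := (torus R n.+1).
Local Notation row := 'rV[R]_n.+1.
Local Notation cells := 'rV['Z_(q * M)]_n.+1.
Implicit Types (x : torus) (v : row) (i j : 'I_n.+1) (u z : cells) (a : 'Z_(q * M)).

Let NN : (1 < N)%N. Proof. exact: N_gt1 q_gt0 M_gt1. Qed.

Let N0 : 0 < N%:R :> R. Proof. by rewrite ltr0n ltnW. Qed.

(* In direction 0 a line is identified with its q translates. *)
Definition period j := if j == ord0 then M else N.
Definition frequency j := if j == ord0 then q else 1%N.

Lemma intr_Zp_eq0 (D : int) : (D%:~R == 0 :> 'Z_(q * M)) = (N%:Z %| D)%Z.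
Proof.
have [r Dr] : exists r : nat, (D %% N%:Z)%Z = r.
  exists `|(D %% N%:Z)%Z|%N; rewrite gez0_abs// modz_ge0// eqz_nat.
  by rewrite -lt0n ltnW.
have rN : (r < N)%N.
  by rewrite -ltz_nat -Dr ltz_pmod// ltz_nat ltnW.
have -> : (N%:Z %| D)%Z = (r == 0)%N.
  by apply/dvdz_mod0P/eqP; rewrite Dr; [case|move=> ->].
rewrite (divz_eq D N%:Z) Dr intrD intrM.
rewrite -[(N%:Z)%:~R]/(N%:R) pchar_Zp// mulr0 add0r -[(r%:Z)%:~R]/(r%:R).
by rewrite -val_eqE/= val_Zp_nat// modn_small.
Qed.

Definition cell_index x j : int := Num.floor (N%:R * torus_coord j x).

Lemma same_line_cell i x u : same_line i (cell (q * M) x) u <->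
  forall j, j != i -> ((period j)%:Z %| cell_index x j - (u 0%R j : nat)%:Z)%Z.
Proof.
have cE j : cell (q * M) x 0 j = (cell_index x j)%:~R by rewrite mxE.
have uE j : u 0 j = ((u 0%R j : nat)%:Z)%:~R by rewrite -[LHS]natr_Zp.
have NN' (D : int) : D%:~R = 0 :> 'Z_(q * M) -> (N%:Z %| D)%Z.
  by move=> D0; rewrite -intr_Zp_eq0 D0.
split.
  move=> /same_lineP[k [a ca]] j ji.
  have := congr1 (fun z : cells => z 0 j) ca; rewrite cE.
  rewrite /shift_vec /unit_vec !mxE/= (negbTE ji) mulr0 addr0.
  rewrite /period; case: (j == ord0) => /=; rewrite ?mulr1 ?mulr0 ?addr0 => e.
    have : (N%:Z %| cell_index x j - (u 0%R j : nat)%:Z - (k : nat)%:Z * M%:Z)%Z.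
      apply: NN'; rewrite !intrD !intrN intrM e -uE -[((k : nat)%:Z)%:~R]/((k : nat)%:R).
      by rewrite natr_Zp -[(M%:Z)%:~R]/(M%:R) [u 0 j + _]addrC addrK subrr.
    move=> ND; rewrite -(subrK ((k : nat)%:Z * M%:Z) (cell_index x j - _)).
    apply: rpredD; last exact: dvdz_mull.
    by apply: dvdz_trans ND; rewrite dvdzE/= dvdn_mull.
  by apply: NN'; rewrite intrD intrN e -uE subrr.
move=> H.
have eqN j : j != i -> j != ord0 -> cell (q * M) x 0 j = u 0 j.
  move=> ji j0; have := H j ji; rewrite /period (negbTE j0) -intr_Zp_eq0.
  by rewrite intrD intrN -cE -uE subr_eq0 => /eqP.
apply/same_lineP; have [i0|i0] := eqVneq i ord0.
  exists 0, (cell (q * M) x 0 i - u 0 i); apply/rowP => j.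
  rewrite scale0r addr0 [RHS]mxE [X in _ = _ + X]mxE /unit_vec [X in _ = _ + _ * X]mxE /=.
  have [->|ji] := eqVneq j i; first by rewrite mulr1 subrKC.
  by rewrite mulr0 addr0 eqN// -i0.
have /dvdzP[p pE] : (M%:Z %| cell_index x ord0 - (u 0%R ord0 : nat)%:Z)%Z.
  by have := H ord0; rewrite /period eqxx; apply; rewrite eq_sym.
exists p%:~R, (cell (q * M) x 0 i - u 0 i); apply/rowP => j.
have -> : (u + p%:~R *: shift_vec q M n +
    (cell (q * M) x 0 i - u 0 i) *: unit_vec q M i) 0 j =
  u 0 j + p%:~R * (M%:R * (j == ord0)%:R) + (cell (q * M) x 0 i - u 0 i) * (j == i)%:R.
  rewrite [LHS]mxE; congr (_ + _); last by rewrite mxE /unit_vec [X in _ * X]mxE.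
  by rewrite mxE; congr (_ + _); rewrite mxE /shift_vec mxE /unit_vec mxE.
have [ji|ji] := eqVneq j i.
  by rewrite ji (negbTE i0) !mulr0 addr0 mulr1 subrKC.
rewrite mulr0 addr0; have [j0|j0] := eqVneq j ord0; last first.
  by rewrite !mulr0 addr0 eqN.
rewrite mulr1 j0; apply/eqP; rewrite addrC -subr_eq {1}[u 0 ord0]uE.
by rewrite cE -intrN -intrD pE intrM.
Qed.

Definition line_amplitude i u a x : R :=
  if same_line i (cell (q * M) x) u then (a : nat)%:R / N%:R else 0.

Definition torus_line_shift i u a : torus -> torus := shear i (line_amplitude i u a).

Lemma measurable_line_amplitude i u a : measurable_fun setT (line_amplitude i u a).
Proof.
rewrite (_ : line_amplitude i u a = fun x => (a : nat)%:R / N%:R *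
    \1_[set x | same_line i (cell (q * M) x) u] x).
  apply: measurable_funM => //; apply: measurable_indic.
  by have [] := torus_measure_cell R NN (fun z => same_line i z u).
apply/funext => x; rewrite /line_amplitude indicE; case: ifPn => h.
  by rewrite mem_set// mulr1.
by rewrite memNset ?mulr0//=; exact/negP.
Qed.

Lemma line_amplitudeD i u a x (c : R) :
  line_amplitude i u a (x + proj (c *: unit_row R i)) = line_amplitude i u a x.
Proof.
rewrite /line_amplitude; congr (if _ then _ else _).
have -> : cell (q * M) (x + proj (c *: unit_row R i)) = cell (q * M) x +
    (cell (q * M) (x + proj (c *: unit_row R i)) 0 i - cell (q * M) x 0 i) *: unit_vec q M i.
  have [v ->] := torusP x; rewrite -projD; apply/rowP => j.
  rewrite [RHS]mxE /unit_vec [X in _ = _ + X]mxE [X in _ = _ + _ * X]mxE /=.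
  have [->|ji] := eqVneq j i; first by rewrite mulr1 subrKC.
  by rewrite mulr0 addr0 !cell_proj// mxE unit_rowE (negbTE ji) addr0.
by rewrite same_lineDe.
Qed.

Lemma torus_line_shift_measure_preserving i u a :
  measure_preserving (torus_line_shift i u a).
Proof.
apply: shear_measure_preserving; first exact: measurable_line_amplitude.
by move=> x c; rewrite line_amplitudeD.
Qed.

Lemma cell_torus_line_shift i u a x :
  cell (q * M) (torus_line_shift i u a x) = line_shift i u a (cell (q * M) x).
Proof.
rewrite /torus_line_shift /shear /line_amplitude /line_shift; case: ifP => _.
  by rewrite cellD_unit// natr_Zp.
by rewrite scale0r proj0 addr0.
Qed.

End line_indicator.

Section step_angle.
Variable R : realType.

Definition step_angle (m : nat) (w : R) : R :=
  2^-1 - 4^-1 * (cos (2 * pi * (w - 2^-1) / m%:R) - cos (pi / m%:R)).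

Lemma step_angle_itv m w : 0 <= step_angle m w <= 1.
Proof.
have := cos_max (2 * pi * (w - 2^-1) / m%:R); have := cos_max (pi / m%:R : R).
rewrite !ler_norml /step_angle => /andP[h1 h2] /andP[h3 h4].
by apply/andP; split; lra.
Qed.

Lemma step_angle_lt (m : nat) w : (0 < m)%N -> (forall k : int, w != k%:~R) ->
  if (m%:Z %| Num.floor w)%Z then step_angle m w < 2^-1 else 2^-1 < step_angle m w.
Proof.
move=> m0 wZ; pose p := Num.floor w; pose D := (p %/ m%:Z)%Z.
have mR : 0 < m%:R :> R by rewrite ltr0n.
have pE : p = D * m%:Z + (p %% m%:Z)%Z by rewrite -divz_eq.
have [r rE] : exists r : nat, (p %% m%:Z)%Z = r.
  exists `|(p %% m%:Z)%Z|%N; rewrite gez0_abs// modz_ge0// eqz_nat.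
  by rewrite -lt0n.
have rm : (r < m)%N by rewrite -ltz_nat -rE ltz_pmod// ltz_nat.
pose s := w - D%:~R * m%:R.
have cosE : cos (2 * pi * (w - 2^-1) / m%:R) = cos (2 * pi * (s - 2^-1) / m%:R).
  rewrite -[RHS](cosD2piz _ D) /s; congr (cos _); field.
  by rewrite lt0r_neq0.
have /andP[w1 w2] := floor_itv w; rewrite -/p in w1 w2.
have sE : s = r%:R + (w - p%:~R).
  by rewrite /s pE rE intrD intrM; ring.
have wp : p%:~R < w by rewrite lt_neqAle w1 eq_sym wZ.
rewrite intrD in w2.
have divE : (m%:Z %| Num.floor w)%Z = (r == 0)%N.
  by apply/dvdz_mod0P/eqP; rewrite -/p rE; [case|move=> ->].
rewrite /step_angle cosE divE.
have [r0|r0] := eqVneq r 0%N.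
  have : 0 < s < 1 by rewrite sE r0; apply/andP; split; lra.
  by move=> /(cos_above m0); lra.
have r1 : 1 <= r%:R :> R by rewrite ler1n lt0n.
have rm1 : r%:R + 1 <= m%:R :> R by rewrite natr1 ler_nat.
have : 1 < s < m%:R by rewrite sE; apply/andP; split; lra.
by move=> /cos_below; lra.
Qed.

End step_angle.
Section torus_null_sets.
Variables (R : realType) (d : nat).
Local Notation torus := (torus R d).

Lemma coord_null j (c : R) : measurable [set x : torus | torus_coord j x = c] /\
  torus_measure [set x : torus | torus_coord j x = c] = 0%E.
Proof.
have mc : measurable [set x : torus | torus_coord j x = c].
  by have := @measurable_coord R d j measurableT [set c] (measurable_set1 c); rewrite setTI.
split => //; have le1 (k : nat) : (torus_measure [set x : torus | torus_coord j x = c]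
    <= (k.+2%:R^-1)%:E)%E.
  have [m1 e1] := torus_measure_cell_coord R (isT : (1 < k.+2)%N) j
    (pred1 (Num.floor (k.+2%:R * c))%:~R).
  have <- : torus_measure [set x : torus |
      pred1 (Num.floor (k.+2%:R * c))%:~R (cell k.+2 x 0 j)] = (k.+2%:R^-1)%:E.
    by rewrite e1 card1 mul1r.
  apply: (torus_measure_le mc m1).
  by move=> x /= xc; rewrite mxE xc.
have ge0 : (0 <= torus_measure [set x : torus | torus_coord j x = c])%E.
  exact: measure_ge0.
apply/eqP; rewrite eq_le ge0 andbT.
apply/lee_addgt0Pr => e e0; rewrite add0e.
have [k ke] : exists k : nat, e^-1 < k.+2%:R.
  exists (Num.truncn e^-1); apply: lt_trans (truncnS_gt _) _.
  by rewrite ltr_nat.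
apply: le_trans (le1 k) _; rewrite lee_fin.
by rewrite -[e]invrK lef_pV2 ?posrE ?invr_gt0// ltW.
Qed.

End torus_null_sets.

Section line_shift_approximation.
Variables (R : realType) (q M n : nat).
Hypotheses (q_gt0 : (0 < q)%N) (M_gt1 : (1 < M)%N).
Let N := (q * M)%N.
Local Notation torus := (torus R n.+1).
Local Notation row := 'rV[R]_n.+1.
Local Notation cells := 'rV['Z_(q * M)]_n.+1.
Implicit Types (x : torus) (v : row) (i j : 'I_n.+1) (u z : cells) (a : 'Z_(q * M)).

Let NN : (1 < N)%N. Proof. exact: N_gt1 q_gt0 M_gt1. Qed.
Let N0 : 0 < N%:R :> R. Proof. by rewrite ltr0n ltnW. Qed.

Definition step_trig j u : trig R n.+1 :=
  TAdd (TConst _ (2^-1 + 4^-1 * cos (pi / (period q M j)%:R)))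
    (TMul (TConst _ (- 4^-1)) (TCos (frequency q j) j
      (TConst _ (- (2 * pi * ((u 0 j : nat)%:R + 2^-1) / (period q M j)%:R))))).

Lemma period_gt0 j : (0 < period q M j)%N.
Proof. by rewrite /period; case: (j == ord0); [exact: ltnW M_gt1|exact: ltnW NN]. Qed.

Lemma frequency_period j : (frequency q j)%:R = N%:R / (period q M j)%:R :> R.
Proof.
have p0 : (period q M j)%:R != 0 :> R by rewrite pnatr_eq0 -lt0n period_gt0.
apply: (mulIf p0); rewrite divfK// -natrM; congr (_%:R).
by rewrite /frequency /period; case: (j == ord0); rewrite ?mul1n.
Qed.

Lemma step_trigE j u v : teval (step_trig j u) v =
  step_angle (period q M j) (N%:R * v 0 j - (u 0 j : nat)%:R).
Proof.
have p0 : (period q M j)%:R != 0 :> R by rewrite pnatr_eq0 -lt0n period_gt0.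
rewrite /= /step_angle frequency_period.
set A := cos (2 * pi * (N%:R / _) * _ + _); set B := cos (2 * pi * (_ - _) / _).
suff -> : A = B by lra.
by rewrite /A /B; congr (cos _); field.
Qed.

Fixpoint trig_pow (t : trig R n.+1) k :=
  if k is k'.+1 then TMul t (trig_pow t k') else TConst _ 1.

Lemma trig_powE t k v : teval (trig_pow t k) v = teval t v ^+ k.
Proof. by elim: k => //= k ->; rewrite exprS. Qed.

Definition bump_trig k t :=
  trig_pow (TAdd (TConst _ 1) (TMul (TConst _ (-1)) (trig_pow t k))) (2 ^ k)%N.

Lemma bump_trigE k t v : teval (bump_trig k t) v = bump k (teval t v).
Proof. by rewrite /bump_trig trig_powE /= trig_powE mulN1r. Qed.

Definition line_trig i u a k : trig R n.+1 :=
  TMul (TConst _ ((a : nat)%:R / N%:R))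
    (foldr (@TMul R n.+1) (TConst _ 1)
       [seq bump_trig k (step_trig j u) | j <- enum 'I_n.+1 & j != i]).

Lemma line_trigE i u a k v : teval (line_trig i u a k) v = (a : nat)%:R / N%:R *
  \prod_(j <- [seq j <- enum 'I_n.+1 | j != i])
     bump k (step_angle (period q M j) (N%:R * v 0 j - (u 0 j : nat)%:R)).
Proof.
rewrite /=; congr (_ * _); elim: [seq _ <- _ | _] => [|j s IH]; first by rewrite big_nil.
by rewrite big_cons /= bump_trigE step_trigE IH.
Qed.

Lemma line_trig_invariant i u a k v (c : R) :
  teval (line_trig i u a k) (v + c *: unit_row R i) = teval (line_trig i u a k) v.
Proof.
rewrite !line_trigE; congr (_ * _); apply: eq_big_seq => j.
by rewrite mem_filter => /andP[ji _]; rewrite mxE unit_rowE (negbTE ji) addr0.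
Qed.

Lemma line_trig_shift i u a k v :
  teval (line_trig i u a k) (v + q%:R^-1 *: unit_row R ord0) = teval (line_trig i u a k) v.
Proof.
rewrite !line_trigE; congr (_ * _); apply: eq_big_seq => j _; congr bump.
rewrite -!step_trigE /= mxE unit_rowE; congr (_ + _ * _).
rewrite /frequency; case: (j == ord0); last by rewrite addr0.
rewrite -[RHS](cosD2piz _ 1); congr (cos _); field.
by rewrite !pnatr_eq0 -!lt0n period_gt0 q_gt0.
Qed.

Lemma line_trig_cvg i u a x : (forall j (b : nat), torus_coord j x <> b%:R / N%:R) ->
  tfun (line_trig i u a k) x @[k --> \oo] --> line_amplitude i u a x.
Proof.
move=> xN; pose v := \row_j torus_coord j x.
have wZ j (m : int) : N%:R * v 0 j - (u 0 j : nat)%:R != m%:~R.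
  apply/eqP => e; have vE : N%:R * v 0 j = (m + (u 0 j : nat)%:Z)%:~R.
    by rewrite intrD -e -[((u 0 j : nat)%:Z)%:~R]/((u 0 j : nat)%:R) subrK.
  have : 0 <= m + (u 0 j : nat)%:Z.
    by rewrite -(ler_int R) -vE mulr_ge0 ?(ltW N0)// mxE coord_ge0.
  move: vE; case: (m + _) => // b vE _; apply: (xN j b).
  by apply: (mulfI (lt0r_neq0 N0)); rewrite [RHS]mulrC divfK ?lt0r_neq0//;
    move: vE; rewrite mxE.
pose l j : R := if ((period q M j)%:Z %| cell_index q M x j - (u 0%R j : nat)%:Z)%Z then 1 else 0.
have lim_j j : bump k (step_angle (period q M j) (N%:R * v 0 j - (u 0 j : nat)%:R))
    @[k --> \oo] --> l j.
  have := step_angle_lt (period_gt0 j) (wZ j).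
  have -> : Num.floor (N%:R * v 0 j - (u 0 j : nat)%:R) =
      cell_index q M x j - (u 0%R j : nat)%:Z.
    rewrite -[(u 0 j : nat)%:R]/(((u 0 j : nat)%:Z)%:~R) -intrN floorDrz ?intr_int//.
    by rewrite intrKfloor mxE.
  have /andP[s0 s1] := step_angle_itv (period q M j) (N%:R * v 0 j - (u 0 j : nat)%:R).
  rewrite /l; case: ifP => _ h; first by apply: bump_cvg1; rewrite s0.
  by apply: bump_cvg0; rewrite h.
rewrite (_ : (fun k => _) = fun k => (a : nat)%:R / N%:R *
    \prod_(j <- [seq j <- enum 'I_n.+1 | j != i])
     bump k (step_angle (period q M j) (N%:R * v 0 j - (u 0 j : nat)%:R))); last first.
  by apply/funext => k; rewrite {1}(proj_coord x) tfun_proj line_trigE.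
rewrite (_ : line_amplitude i u a x = (a : nat)%:R / N%:R *
    \prod_(j <- [seq j <- enum 'I_n.+1 | j != i]) l j).
  by apply: cvgM; [exact: cvg_cst|exact: cvg_prod_seq].
rewrite /line_amplitude; case: ifPn => sl.
  rewrite big_seq big1 ?mulr1// => j; rewrite mem_filter => /andP[ji _].
  by rewrite /l ((same_line_cell q_gt0 M_gt1 i x u).1 sl).
have [j ji lj] : exists2 j, j != i & l j = 0.
  apply: contrapT => H; move/negP : sl; apply; apply/same_line_cell => // j ji.
  by apply: contrapT => /negP hj; apply: H; exists j => //; rewrite /l (negbTE hj).
rewrite (bigD1_seq j)//= ?lj ?mul0r ?mulr0//.
  by rewrite mem_filter ji mem_enum.
by rewrite filter_uniq// enum_uniq.
Qed.

End line_shift_approximation.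

Section approximable.
Variables (R : realType) (n q : nat).
Local Notation torus := (torus R n.+1).
Implicit Types (g h : torus -> torus).

Definition approximable g := forall e delta : R, 0 < e -> 0 < delta ->
  exists h (E : set torus), [/\ trig_diffeo h,
    forall x, h (phi q%:R^-1 x) = phi q%:R^-1 (h x),
    measurable E, (torus_measure E < delta%:E)%E &
    forall x, ~ E x -> close e (h x) (g x)].

Lemma approximable_id : approximable id.
Proof.
move=> e delta e0 d0; exists id, set0; split => //.
- exact: trig_diffeo_id.
- by rewrite /torus_measure preimage_set0 set0I measure0 lte_fin.
- by move=> x _; apply: closeW (close_refl x); exact: ltW.
Qed.

Lemma approximable_comp g g' : measure_preserving g' ->
  approximable g -> approximable g' -> approximable (g \o g').
Proof.
move=> mg' ag ag' e delta e0 d0.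
have e2 : 0 < e / 2 by rewrite divr_gt0.
have d2 : 0 < delta / 2 by rewrite divr_gt0.
have [h [E [dh hT mE Ed hg]]] := ag _ _ e2 d2.
have [mh [_ [a [_ [_ ha _]]]]] := dh.
have [L L0 hL] := trig_lift_lipschitz ha.
have e3 : 0 < e / 2 / (L + 1) by rewrite divr_gt0// ltr_wpDl.
have [h' [E' [dh' h'T mE' E'd hg']]] := ag' _ _ e3 d2.
have [mgE gE] := mg' E mE.
exists (h \o h'), (E' `|` g' @^-1` E); split.
- exact: trig_diffeo_comp.
- by move=> x /=; rewrite h'T hT.
- exact: measurableU.
- apply: le_lt_trans (torus_measureU_le mE' mgE) _.
  by rewrite gE [delta]splitr EFinD lteD.
- move=> x nE; have h1 : close (e / 2 / (L + 1)) (h' x) (g' x).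
    by apply: hg' => Ex; apply: nE; left.
  have h2 : close (e / 2) (h (g' x)) (g (g' x)) by apply: hg => Ex; apply: nE; right.
  apply: closeW (close_trans (hL _ _ _ h1) h2).
  rewrite [leRHS]splitr lerD2r mulrCA ler_piMr ?(ltW e2)//.
  by rewrite ler_pdivrMr ?mul1r ?lerDl// ltr_wpDl.
Qed.

Lemma shear_shift i f (x : torus) : (forall y, f (phi q%:R^-1 y) = f y) ->
  shear i f (phi q%:R^-1 x) = phi q%:R^-1 (shear i f x).
Proof. by move=> fT; rewrite /shear fT /phi addrAC. Qed.

End approximable.

Section line_shifts_approximable.
Variables (R : realType) (q M n : nat).
Hypotheses (q_gt0 : (0 < q)%N) (M_gt1 : (1 < M)%N).
Local Notation torus := (torus R n.+1).
Local Notation cells := 'rV['Z_(q * M)]_n.+1.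

Lemma torus_line_shift_approximable i (u : cells) (a : 'Z_(q * M)) :
  approximable q (torus_line_shift (R := R) i u a).
Proof.
move=> e delta e0 d0; pose F k := tfun (line_trig R i u a k).
have ae : {ae @torus_measure R n.+1, forall x, setT x ->
    F ^~ x @ \oo --> line_amplitude i u a x}.
  pose Zb b k := if insub k is Some j then
    [set x : torus | torus_coord (j : 'I_n.+1) x = b%:R / (q * M)%:R] else set0.
  have mZb b k : measurable (Zb b k).
    by rewrite /Zb; case: insub => // j; have [] := coord_null j (b%:R / (q * M)%:R : R).
  have Zb0 b k : (@torus_measure R n.+1).-negligible (Zb b k).
    apply/negligibleP => //; rewrite /Zb; case: insub => [j|]; last exact: measure0.
    by have [] := coord_null j (b%:R / (q * M)%:R : R).
  apply: (negligibleS _ (negligible_bigcup (fun b => negligible_bigcup (Zb0 b)))).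
  move=> x /= nF; apply: contrapT => xZ; apply: nF => _.
  apply: line_trig_cvg => // j b jb; apply: xZ; exists b => //; exists j => //.
  by rewrite /Zb valK.
have fin : (torus_measure (setT : set torus) < +oo)%E by rewrite torus_measureT ltry.
have [B [mB Bd Bu]] := ae_pointwise_almost_uniform (fun k => measurable_tfun _)
  (measurable_line_amplitude q_gt0 M_gt1 i u a) measurableT fin ae d0.
have [k Fk] : exists k, forall x, ~ B x -> `|line_amplitude i u a x - F k x| <= e.
  pose P := [set f : torus -> R | forall x, (setT `\` B) x ->
    `|line_amplitude i u a x - f x| < e].
  have [k _ Pk] : (F @ \oo) P.
    apply: Bu; apply/uniform_nbhs; exists [set p | `|p.1 - p.2| < e]; split => //.
    exact: (entourage_ball (R : pseudoMetricType R) (PosNum e0)).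
  by exists k => x nB; apply/ltW/(Pk k) => /=.
exists (shear i (F k)), B; split => //.
- by apply: trig_diffeo_shear => v c; exact: line_trig_invariant.
- move=> x; apply: shear_shift => y; have [v ->] := torusP y.
  by rewrite /F /phi -projD !tfun_proj line_trig_shift.
- move=> x nB; exists ((line_amplitude i u a x - F k x) *: unit_row R i).
    by rewrite /torus_line_shift /shear -addrA -projD -scalerDl subrKC.
  move=> j; rewrite unit_rowE; case: ifP => _; first exact: Fk.
  by rewrite normr0 ltW.
Qed.

Lemma line_shifts_torus (gamma : cells -> cells) : line_shifts gamma ->
  exists g : torus -> torus, [/\ measure_preserving g, approximable q g &
    forall x, cell (q * M) (g x) = gamma (cell (q * M) x)].
Proof.
elim=> [|i u a f _ [g [mg ag gf]]].
  by exists id; split => //; exact: approximable_id.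
exists (torus_line_shift i u a \o g); split.
- apply: measure_preserving_comp mg; exact: torus_line_shift_measure_preserving.
- apply: approximable_comp => //; exact: torus_line_shift_approximable.
- by move=> x /=; rewrite cell_torus_line_shift// gf.
Qed.

End line_shifts_approximable.
(** * Block slides *)

Lemma threshold_cases (l K : nat) (p : int) : (l < K)%N -> l%:Z != 0 ->
  l%:Z != K%:Z - 1 -> l%:Z != p - 1 -> l%:Z != p -> l%:Z != p + 1 ->
  [/\ (0 < l)%N, (l + 2 <= K)%N & (l%:Z <= p - 2) \/ (p + 2 <= l%:Z)].
Proof. by move=> lK l0 l1 p1 p2 p3; split; lia. Qed.

Section block_slides.
Variables (R : realType) (d : nat).
Local Notation torus := (torus R d).
Implicit Types (x : torus) (v : 'rV[R]_d) (i j : 'I_d) (s : R -> R).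

Lemma slide_shear i j s : slide (R := R) i j s = shear i (fun x => s (torus_coord j x)).
Proof. by []. Qed.

Lemma measurable_step_function s : step_function s -> measurable_fun setT s.
Proof.
move=> [n [c [J [_ sE]]]].
rewrite (_ : s = fun y => \sum_k c k * \1_[set` J k] y); last exact/funext.
apply: measurable_sum => k; exact: measurable_funM.
Qed.

Lemma coordD_unit i j x (c : R) : i != j ->
  torus_coord j (x + proj (c *: unit_row R i)) = torus_coord j x.
Proof.
move=> ij; have [v ->] := torusP x.
by rewrite -projD !coord_proj mxE unit_rowE eq_sym (negbTE ij) addr0.
Qed.

Lemma slide_measure_preserving i j s : i != j -> step_function s ->
  measure_preserving (slide (R := R) i j s).
Proof.
move=> ij ss; rewrite slide_shear; apply: shear_measure_preserving.
  apply: (measurableT_comp (measurable_step_function ss)).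
  exact: measurable_coord.
by move=> x c; rewrite coordD_unit.
Qed.

Lemma block_slide_measure_preserving (g : torus -> torus) :
  block_slide g -> measure_preserving g.
Proof.
elim=> [|i j s h ij ss _ mh]; first exact: measure_preserving_id.
by apply: measure_preserving_comp mh; exact: slide_measure_preserving.
Qed.

Definition locally_constant (T : Type) j (f : R -> T) := forall delta : R, 0 < delta ->
  exists2 r : R, 0 < r & exists E : set torus,
    [/\ measurable E, (torus_measure E < delta%:E)%E &
    forall x v, ~ E x -> (forall k, `|v 0 k| < r) ->
      f (torus_coord j (x + proj v)) = f (torus_coord j x)].

Lemma locally_constant_cst (T : Type) j (a : T) : locally_constant j (fun=> a).
Proof.
move=> delta d0; exists 1 => //; exists set0; split => //.
by rewrite /torus_measure preimage_set0 set0I measure0 lte_fin.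
Qed.

Lemma locally_constant2 (T U V : Type) (F : T -> U -> V) j f g :
  locally_constant j f -> locally_constant j g ->
  locally_constant j (fun y => F (f y) (g y)).
Proof.
move=> lf lg delta d0; have d2 : 0 < delta / 2 by rewrite divr_gt0.
have [r r0 [E [mE Ed hE]]] := lf _ d2; have [r' r'0 [E' [mE' E'd hE']]] := lg _ d2.
exists (Num.min r r'); first by rewrite lt_min r0.
exists (E `|` E'); split; first exact: measurableU.
  apply: le_lt_trans (torus_measureU_le mE mE') _.
  by rewrite [delta]splitr EFinD lteD.
move=> x v nE vr; rewrite hE ?hE' => [//|Ex|k|Ex|k].
- by apply: nE; right.
- by apply: lt_le_trans (vr k) _; rewrite ge_min lexx orbT.
- by apply: nE; left.
- by apply: lt_le_trans (vr k) _; rewrite ge_min lexx.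
Qed.

Lemma locally_constant_threshold (T : Type) j (f : R -> T) (c : R) :
  (forall a b, a < c -> b < c -> f a = f b) ->
  (forall a b, c < a -> c < b -> f a = f b) -> locally_constant j f.
Proof.
move=> flt fgt delta d0.
have [K K1 Kd] : exists2 K : nat, (1 < K)%N & 5 / K%:R < delta.
  exists (Num.truncn (5 / delta)).+3 => //.
  rewrite ltr_pdivrMr// mulrC -ltr_pdivrMr//; apply: lt_trans (truncnS_gt _) _.
  by rewrite ltr_nat.
have K0 : 0 < K%:R :> R by rewrite ltr0n ltnW.
pose p := Num.floor (K%:R * c).
pose bad : seq 'Z_K := [:: 0; -1; (p - 1)%:~R; p%:~R; (p + 1)%:~R].
have [mE eE] := torus_measure_cell_coord R K1 j (mem bad).
exists K%:R^-1; first by rewrite invr_gt0.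
exists [set x : torus | (mem bad) (cell K x 0 j)]; split => //.
  rewrite eE lte_fin; apply: le_lt_trans Kd; rewrite ler_wpM2r ?invr_ge0//.
  by rewrite (ler_nat R _ 5) (leq_trans (card_size _)).
move=> x v /= nbad vr.
have [l lK xl] := torus_coord_floor (R := R) K1 x j.
have cl : cell K x 0 j = (l%:Z)%:~R by rewrite mxE xl.
have lbad (m : int) : (m%:~R : 'Z_K) \in bad -> l%:Z != m.
  by move=> mb; apply/eqP => lm; apply: nbad; rewrite cl lm.
have l0 : l%:Z != 0 by apply: lbad; rewrite mulr0z !inE eqxx.
have l1 : l%:Z != K%:Z - 1.
  apply: lbad; rewrite intrD -[(K%:Z)%:~R]/(K%:R) pchar_Zp// add0r intrN.
  by rewrite !inE eqxx orbT.
have lp1 : l%:Z != p - 1 by apply: lbad; rewrite !inE eqxx !orbT.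
have lp : l%:Z != p by apply: lbad; rewrite !inE eqxx !orbT.
have lp2 : l%:Z != p + 1 by apply: lbad; rewrite !inE eqxx !orbT.
have /andP[x1 x2] := floor_itv (K%:R * torus_coord j x).
have /andP[c1 c2] := floor_itv (K%:R * c).
rewrite xl intrD -[(l%:Z)%:~R]/(l%:R) in x1 x2; rewrite -/p intrD in c1 c2.
have vK : `|K%:R * v 0 j| < 1.
  by rewrite normrM gtr0_norm// mulrC -ltr_pdivlMr// div1r.
move: vK; rewrite ltr_norml => /andP[v1 v2].
have [l1n l2n cases] := threshold_cases lK l0 l1 lp1 lp lp2.
have l1' : 1 <= l%:R :> R by rewrite ler1n.
have l2' : l%:R + 2 <= K%:R :> R by rewrite -natrD ler_nat.
have xv : torus_coord j (x + proj v) = torus_coord j x + v 0 j.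
  rewrite coordD frac_id//; apply/andP; split.
    by rewrite -(pmulr_rge0 _ K0) mulrDr; lra.
  by rewrite -(ltr_pM2l K0) mulrDr mulr1; lra.
rewrite xv; move: (torus_coord j x) (v 0 j) x1 x2 v1 v2 => y w x1 x2 v1 v2.
have [lep|gtp] := cases.
  have : l%:R <= p%:~R - 2 :> R.
    by rewrite -[l%:R]/((l%:Z)%:~R) -[2]/((2%:Z)%:~R) -intrB ler_int.
  move=> lep'; apply: flt; rewrite -(ltr_pM2l K0) ?mulrDr; lra.
have : p%:~R + 2 <= l%:R :> R.
  by rewrite -[l%:R]/((l%:Z)%:~R) -[2]/((2%:Z)%:~R) -intrD ler_int.
by move=> lep'; apply: fgt; rewrite -(ltr_pM2l K0) ?mulrDr; lra.
Qed.

Lemma locally_constant_itv j (J : interval R) :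
  locally_constant j (fun y => y \in J).
Proof.
case: J => a b.
apply: (@locally_constant2 _ _ _ andb j (fun y => (a <= BLeft y)%O) (fun y => (BRight y <= b)%O)).
- case: a => [[] c|[]]; try exact: locally_constant_cst.
  + apply: (@locally_constant_threshold _ _ _ c) => u w /= uc wc; rewrite !bnd_simp.
      by rewrite !leNgt uc wc.
    by rewrite !ltW.
  + apply: (@locally_constant_threshold _ _ _ c) => u w /= uc wc; rewrite !bnd_simp.
      by rewrite !ltNge !ltW.
    by rewrite uc wc.
- case: b => [[] c|[]]; try exact: locally_constant_cst.
  + apply: (@locally_constant_threshold _ _ _ c) => u w /= uc wc; rewrite !bnd_simp.
      by rewrite uc wc.
    by rewrite !ltNge !ltW.
  + apply: (@locally_constant_threshold _ _ _ c) => u w /= uc wc; rewrite !bnd_simp.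
      by rewrite !ltW.
    by rewrite !leNgt uc wc.
Qed.

Lemma locally_constant_step_function j s : step_function s -> locally_constant j s.
Proof.
move=> [n [c [J [_ sE]]]].
rewrite (_ : s = fun y => \sum_k c k * \1_[set` J k] y); last exact/funext.
elim: (index_enum _) => [|k l IH].
  rewrite (_ : (fun y => _) = fun=> 0); first exact: locally_constant_cst.
  by apply/funext => y; rewrite big_nil.
rewrite (_ : (fun y => _) =
    fun y => c k * (y \in J k)%:R + \sum_(k <- l) c k * \1_[set` J k] y).
  have := locally_constant2 (fun (b : bool) (t : R) => c k * b%:R + t)
    (locally_constant_itv j (J k)) IH.
  exact.
by apply/funext => y; rewrite big_cons indicE mem_setE.
Qed.

Definition locally_translation (g : torus -> torus) := forall delta : R, 0 < delta ->
  exists2 r : R, 0 < r & exists E : set torus,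
    [/\ measurable E, (torus_measure E < delta%:E)%E &
    forall x v, ~ E x -> (forall k, `|v 0 k| < r) -> g (x + proj v) = g x + proj v].

Lemma block_slide_locally_translation (g : torus -> torus) :
  block_slide g -> locally_translation g.
Proof.
elim=> [|i j s h ij ss bh lh] delta d0.
  exists 1 => //; exists set0; split => //.
  by rewrite /torus_measure preimage_set0 set0I measure0 lte_fin.
have d2 : 0 < delta / 2 by rewrite divr_gt0.
have [r r0 [E [mE Ed hE]]] := lh _ d2.
have [r' r'0 [E' [mE' E'd hE']]] := locally_constant_step_function j ss d2.
have [mhE hE'E] := block_slide_measure_preserving bh mE'.
exists (Num.min r r'); first by rewrite lt_min r0.
exists (E `|` h @^-1` E'); split; first exact: measurableU.
  apply: le_lt_trans (torus_measureU_le mE mhE) _.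
  by rewrite hE'E [delta]splitr EFinD lteD.
move=> x v nE vr; rewrite /= hE => [|Ex|k].
- rewrite /slide hE' => [|Ex|k]; first by rewrite addrAC.
    by apply: nE; right.
  by apply: lt_le_trans (vr k) _; rewrite ge_min lexx orbT.
- by apply: nE; left.
- by apply: lt_le_trans (vr k) _; rewrite ge_min lexx.
Qed.

End block_slides.
(** * Matching and approximation *)

Section orbits.
Variables (q M n : nat).
Local Notation cells := 'rV['Z_(q * M)]_n.+1.
Local Notation T := (shift_vec q M n).
Implicit Types (z h : cells).

Definition orbit_rep z : cells := odflt 0 [pick h | same_orbit z h].

Lemma orbit_rep_same z : same_orbit z (orbit_rep z).
Proof.
by rewrite /orbit_rep; case: pickP => [//|/(_ z)]; rewrite same_orbit_refl.
Qed.

Lemma orbit_rep_eq z h : same_orbit z h -> orbit_rep z = orbit_rep h.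
Proof.
move=> zh; congr odflt; apply: eq_pick => u; apply/idP/idP.
  exact/same_orbit_trans/same_orbit_sym.
exact: same_orbit_trans.
Qed.

Lemma orbit_rep_idem z : orbit_rep (orbit_rep z) = orbit_rep z.
Proof. by apply: orbit_rep_eq; apply: same_orbit_sym; exact: orbit_rep_same. Qed.

Lemma orbit_repDT z (k : 'Z_(q * M)) : orbit_rep (z + k *: T) = orbit_rep z.
Proof. by apply: orbit_rep_eq; apply/same_orbitP; exists k. Qed.

Lemma card_orbit_rep (b : cells) : orbit_rep b = b ->
  #|[pred z | orbit_rep z == b]| = #|[pred z | same_orbit z (0 : cells)]|.
Proof.
move=> bb; rewrite -[RHS](fintype.card_image (addrI (b : cells))); apply: eq_card => z.
apply/idP/fintype.imageP => [|[w]]; rewrite !inE.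
  move=> /eqP zb; exists (z - b); last by rewrite subrKC.
  rewrite inE -(same_orbitDr _ _ b) subrK add0r -zb; exact: orbit_rep_same.
move=> w0 ->; apply/eqP; rewrite -[RHS]bb; apply: orbit_rep_eq.
by rewrite addrC -[X in same_orbit _ X]add0r same_orbitDr.
Qed.

Lemma card_orbit_gt0 : (0 < #|[pred z : cells | same_orbit z (0 : cells)]|)%N.
Proof. by apply/card_gt0P; exists 0; rewrite inE same_orbit_refl. Qed.

Lemma card_orbit_union (B : {set cells}) : (forall b, b \in B -> orbit_rep b = b) ->
  #|[pred z | orbit_rep z \in B]| = (#|B| * #|[pred z | same_orbit z (0 : cells)]|)%N.
Proof.
move=> BB; rewrite -[LHS]sum1_card (partition_big orbit_rep (mem B)) //=.
rewrite -sum_nat_const; apply: eq_bigr => b bB.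
rewrite -(card_orbit_rep (BB b bB)) -sum1_card; apply: eq_bigl => z.
by rewrite !inE; case: eqP => [->|]; rewrite ?bB ?andbF.
Qed.

End orbits.

Section matching.
Variables (R : realType) (q M n : nat) (hh : torus R n.+1 -> torus R n.+1).
Hypotheses (q_gt0 : (0 < q)%N) (M_gt1 : (1 < M)%N).
Hypotheses (hh_mp : measure_preserving hh)
  (hh_phi : forall x, hh (phi q%:R^-1 x) = phi q%:R^-1 (hh x)).
Local Notation torus := (torus R n.+1).
Local Notation cells := 'rV['Z_(q * M)]_n.+1.
Local Notation T := (shift_vec q M n).
Implicit Types (x : torus) (z b w : cells) (k : 'Z_(q * M)).

Let NN : (1 < q * M)%N. Proof. exact: N_gt1 q_gt0 M_gt1. Qed.

Definition phi_iter (m : nat) x : torus := x + proj (q%:R^-1 *: unit_row R ord0) *+ m.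

Lemma phi_iterS m x : phi_iter m.+1 x = phi q%:R^-1 (phi_iter m x).
Proof. by rewrite /phi_iter mulrSr addrA. Qed.

Lemma phi_iter_comm m x : hh (phi_iter m x) = phi_iter m (hh x).
Proof.
elim: m => [|m IH]; first by rewrite /phi_iter !mulr0n !addr0.
by rewrite !phi_iterS hh_phi IH.
Qed.

Lemma cell_phi_iter (m : nat) x : cell (q * M) (phi_iter m x) = cell (q * M) x + m%:R *: T.
Proof.
elim: m => [|m IH]; first by rewrite /phi_iter mulr0n addr0 scale0r addr0.
rewrite phi_iterS /phi -[in RHS]natr1 [in RHS]scalerDl scale1r addrA -IH.
have -> : q%:R^-1 = M%:R / (q * M)%:R :> R.
  rewrite natrM; field.
  by rewrite !pnatr_eq0 -!lt0n q_gt0 ltnW.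
by rewrite (cellD_unit NN).
Qed.

(* Hall's condition holds because hh preserves the measure and all the cells have
   the same measure. *)
Lemma equivariant_matching : exists tau : cells -> cells, [/\ injective tau,
  forall z k, tau (z + k *: T) = tau z + k *: T &
  forall z, exists2 x, cell (q * M) x = z & cell (q * M) (hh x) = tau z].
Proof.
pose rep x := orbit_rep (cell (q * M) x).
pose r b w := `[< exists2 x, rep x = b & rep (hh x) = w >].
pose X0 : {set cells} := [set z | orbit_rep z == z]%SET.
have cN : 0 < #|{: cells}|%:R :> R.
  by rewrite ltr0n; apply/card_gt0P; exists 0.
have hallX (B : {set cells}) : B \subset X0 -> (#|B| <= #|rel_img r B|)%N.
  move=> /fintype.subsetP BX0.
  have BB b : b \in B -> orbit_rep b = b by move=> /BX0; rewrite inE => /eqP.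
  have NBB b : b \in rel_img r B -> orbit_rep b = b.
    by move=> /rel_imgP[z _ /asboolP[x _ <-]]; exact: orbit_rep_idem.
  rewrite -(leq_pmul2r (card_orbit_gt0 q M n)) -!card_orbit_union//.
  have [mB eB] := torus_measure_cell R NN [pred z | orbit_rep z \in B].
  have [mN eN] := torus_measure_cell R NN [pred z | orbit_rep z \in rel_img r B].
  have [mhN ehN] := hh_mp mN.
  have sub : [set x : torus | [pred z | orbit_rep z \in B] (cell (q * M) x)] `<=`
      hh @^-1` [set x | [pred z | orbit_rep z \in rel_img r B] (cell (q * M) x)].
    move=> x xB; have repB : rep x \in B by exact: xB.
    suff : rep (hh x) \in rel_img r B by [].
    apply/rel_imgP.
    exists (rep x); first exact: repB.
    apply/asboolP.
    exists x; reflexivity.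
  have := torus_measure_le mB mhN sub; rewrite ehN eB eN lee_fin.
  rewrite ler_pM2r; last by rewrite invr_gt0; exact: cN.
  by rewrite ler_nat => leBN; exact: leBN.
have [sigma [sigma_inj sigma_r]] := hall_matching hallX.
have X0rep z : orbit_rep z \in X0 by rewrite inE orbit_rep_idem.
have wit z : {x | rep x = orbit_rep z & rep (hh x) = sigma (orbit_rep z)}.
  apply: cid2; have /asboolP[x x1 x2] := sigma_r _ (X0rep z).
  by exists x.
pose y z := s2val (wit (orbit_rep z)).
have y1 z : rep (y z) = orbit_rep z.
  by rewrite /y; case: (wit _) => x /= ->; rewrite orbit_rep_idem.
have y2 z : rep (hh (y z)) = sigma (orbit_rep z).
  by rewrite /y; case: (wit _) => x /= _ ->; rewrite orbit_rep_idem.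
have yk z : exists k, z = cell (q * M) (y z) + k *: T.
  apply/same_orbitP; apply: same_orbit_trans (orbit_rep_same z) _.
  rewrite -y1; apply: same_orbit_sym; exact: orbit_rep_same.
have zky z k : z = cell (q * M) (y z) + k *: T -> z - cell (q * M) (y z) = k *: T.
  by move=> e; apply/eqP; rewrite subr_eq addrC -e.
have yT z k : y (z + k *: T) = y z by rewrite /y orbit_repDT.
pose tau z := cell (q * M) (hh (y z)) + (z - cell (q * M) (y z)).
have tauT z k : tau (z + k *: T) = tau z + k *: T.
  by rewrite /tau yT -!addrA; congr (_ + (_ + _)); rewrite addrC.
have tau_rep z : orbit_rep (tau z) = sigma (orbit_rep z).
  have [k zk] := yk z; rewrite /tau (zky _ _ zk).
  by rewrite orbit_repDT -y2.
exists tau; split; [|exact: tauT|].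
- move=> z w zw; have : sigma (orbit_rep z) = sigma (orbit_rep w) by rewrite -!tau_rep zw.
  move=> /(sigma_inj _ _ (X0rep z) (X0rep w)) rzw.
  by move: zw; rewrite /tau /y rzw => /addrI /addIr.
- move=> z; have [k zk] := yk z; exists (phi_iter k (y z)).
    by rewrite cell_phi_iter natr_Zp -zk.
  rewrite phi_iter_comm cell_phi_iter natr_Zp /tau; congr (_ + _).
  by rewrite (zky _ _ zk).
Qed.

End matching.
Section approximation.
Variables (R : realType) (d q : nat) (hh : torus R d.+2 -> torus R d.+2).
Hypotheses (q_gt0 : (0 < q)%N) (hh_slide : block_slide hh)
  (hh_phi : forall x, hh (phi q%:R^-1 x) = phi q%:R^-1 (hh x)).
Local Notation torus := (torus R d.+2).

Lemma hub_measure (M : nat) (i1 : 'I_d.+2)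
    (tau : 'rV['Z_(q * M)]_d.+2 -> 'rV['Z_(q * M)]_d.+2) : (1 < M)%N -> injective tau ->
  measurable [set x : torus | hub i1 (tau (cell (q * M) x))] /\
  (torus_measure [set x : torus | hub i1 (tau (cell (q * M) x))] <=
    (2 / (q * M)%:R)%:E)%E.
Proof.
move=> M_gt1 tau_inj; have NN : (1 < q * M)%N by exact: N_gt1 q_gt0 M_gt1.
have [m1 e1] := torus_measure_cell R NN (fun z => hub i1 (tau z)).
have [m2 e2] := torus_measure_cell R NN (fun z => hub i1 z).
have [m3 e3] := torus_measure_cell_coord R NN i1 (pred2 0 1).
split; first exact: m1.
apply: (@le_trans _ _ (torus_measure [set x : torus | hub i1 (cell (q * M) x)])).
  rewrite e1 e2 lee_fin ler_wpM2r ?invr_ge0// ler_nat.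
  rewrite -(fintype.card_image tau_inj); apply: subset_leq_card.
  by apply/fintype.subsetP => _ /fintype.imageP[z zh ->].
have e3' : torus_measure [set x : torus | hub i1 (cell (q * M) x)] =
    (#|pred2 (0 : 'Z_(q * M)) 1|%:R / (q * M)%:R)%:E by exact: e3.
rewrite e3' lee_fin ler_wpM2r ?invr_ge0//.
by rewrite (ler_nat R _ 2) card2; case: eqP.
Qed.

Lemma analytic_approximation (eps delta : R) : 0 < eps -> 0 < delta ->
  exists (h : torus -> torus) (E : set torus), [/\ Diff_omega_infty h,
    forall x, h (phi q%:R^-1 x) = phi q%:R^-1 (h x),
    measurable E, (torus_measure E < delta%:E)%E &
    forall x, ~ E x -> torus_dist (h x) (hh x) <= eps].
Proof.
move=> eps0 delta0; have hh_mp := block_slide_measure_preserving hh_slide.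
pose S : R := Num.sqrt d.+2%:R; have S0 : 0 <= S by exact: sqrtr_ge0.
pose c := eps / (S + 1); have S1 : 0 < S + 1 by rewrite ltr_wpDl.
have c0 : 0 < c by rewrite divr_gt0.
have c2 : 0 < c / 2 by rewrite divr_gt0.
have d3 : 0 < delta / 3 by rewrite divr_gt0.
have [r r0 [E1 [mE1 E1d hE1]]] := block_slide_locally_translation hh_slide d3.
have [M M_gt1 [Mr Md Mc]] : exists2 M : nat, (1 < M)%N &
    [/\ r^-1 < M%:R, 6 / delta < M%:R & 4 / c < M%:R].
  exists (Num.truncn (r^-1 + 6 / delta + 4 / c)).+2 => //.
  have : r^-1 + 6 / delta + 4 / c < (Num.truncn (r^-1 + 6 / delta + 4 / c)).+2%:R.
    by apply: lt_trans (truncnS_gt _) _; rewrite ltr_nat.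
  have : 0 < r^-1 by rewrite invr_gt0.
  have : 0 < 6 / delta by rewrite divr_gt0.
  have : 0 < 4 / c by rewrite divr_gt0.
  by move=> h1 h2 h3 h4; split; lra.
have NN : (1 < q * M)%N by exact: N_gt1 q_gt0 M_gt1.
have N0 : 0 < (q * M)%:R :> R by rewrite ltr0n ltnW.
have MN : M%:R <= (q * M)%:R :> R by rewrite ler_nat leq_pmull.
have Nr : (q * M)%:R^-1 < r.
  by rewrite -[r]invrK ltf_pV2 ?posrE ?invr_gt0// (lt_le_trans Mr).
have Nd : 2 / (q * M)%:R < delta / 3.
  rewrite ltr_pdivrMr//; move: Md; rewrite ltr_pdivrMr// => Md.
  have : M%:R * delta <= (q * M)%:R * delta by rewrite ler_pM2r.
  by lra.
have Nc : (q * M)%:R^-1 + (q * M)%:R^-1 <= c / 2.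
  have -> : (q * M)%:R^-1 + (q * M)%:R^-1 = 2 / (q * M)%:R :> R by lra.
  rewrite ler_pdivrMr//; move: Mc; rewrite ltr_pdivrMr// => Mc.
  have : M%:R * c <= (q * M)%:R * c by rewrite ler_pM2r.
  by lra.
have [tau [tau_inj tauT tau_hh]] := equivariant_matching q_gt0 M_gt1 hh_mp hh_phi.
pose i1 : 'I_d.+2 := lift ord0 ord0.
have [gamma Ggamma gammaE] := line_shifts_routing q_gt0 M_gt1 (isT : i1 != ord0) tau_inj tauT.
have [g [mg ag gE]] := line_shifts_torus R q_gt0 M_gt1 Ggamma.
have [h [E2 [dh hT mE2 E2d hg]]] := ag _ _ c2 d3.
have [mH Hd] := hub_measure i1 M_gt1 tau_inj.
pose H := [set x : torus | hub i1 (tau (cell (q * M) x))].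
exists h, (E1 `|` (H `|` E2)); split.
- exact: trig_diffeo_Diff_omega.
- exact: hT.
- by apply: measurableU => //; exact: measurableU.
- apply: le_lt_trans (torus_measureU_le mE1 (measurableU _ _ mH mE2)) _.
  have -> : delta%:E = ((delta / 3)%:E + ((delta / 3)%:E + (delta / 3)%:E))%E.
    by rewrite -!EFinD; congr EFin; lra.
  apply: lteD; first exact: E1d.
  apply: le_lt_trans (torus_measureU_le mH mE2) _.
  by apply: lteD; [apply: le_lt_trans Hd _; rewrite lte_fin; exact: Nd|exact: E2d].
- move=> x nE.
  have nE1 : ~ E1 x by move=> Ex; apply: nE; left.
  have nH : ~~ hub i1 (tau (cell (q * M) x)).
    by apply/negP => Hx; apply: nE; right; left.
  have nE2 : ~ E2 x by move=> Ex; apply: nE; right; right.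
  have [y yx yhh] := tau_hh (cell (q * M) x).
  have [v vE vN] := cell_close NN (esym yx).
  have hy : close (q * M)%:R^-1 (hh y) (hh x).
    apply: close_sym; exists v => [|j]; last exact: ltW.
    by rewrite vE hE1// => j; exact: lt_trans (vN j) Nr.
  have gy : close (q * M)%:R^-1 (g x) (hh y).
    have gx : cell (q * M) (g x) = cell (q * M) (hh y) by rewrite gE gammaE// yhh.
    by have [w wE wN] := cell_close NN gx; exists w => // j; exact: ltW.
  have hc : close c (h x) (hh x).
    apply: closeW (close_trans (hg x nE2) (close_trans gy hy)).
    by rewrite [leRHS]splitr lerD2l.
  apply: le_trans (torus_dist_close (ltW c0) hc) _.
  rewrite -/S /c mulrCA ler_piMr ?(ltW eps0)//.
  by rewrite ler_pdivrMr// mul1r lerDl.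
Qed.

End approximation.

Lemma block_slide_dim1 (R : realType) (h : torus R 1 -> torus R 1) :
  block_slide h -> h = id.
Proof.
by elim=> // i j s g; rewrite (ord1 i) (ord1 j) eqxx.
Qed.

Theorem proposition2p20 (R : realType) (d : nat)
    (hh : torus R d.+1 -> torus R d.+1) (q : nat) :
  block_slide hh -> (0 < q)%N ->
  hh \o phi (q%:R^-1) = phi (q%:R^-1) \o hh ->
  forall eps delta : R, 0 < eps -> 0 < delta ->
  exists h : torus R d.+1 -> torus R d.+1,
    [/\ Diff_omega_infty h,
        exists E : set (torus R d.+1),
          [/\ measurable E, (torus_measure E < delta%:E)%E &
              (ereal_sup [set (torus_dist (h x) (hh x))%:E | x in ~` E]
                 < eps%:E)%E] &
        h \o phi (q%:R^-1) = phi (q%:R^-1) \o h].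
Proof.
move=> hh_slide q_gt0 hh_phi eps delta eps0 delta0.
have [h [E [Dh hT mE Ed hE]]] : exists h (E : set (torus R d.+1)),
    [/\ Diff_omega_infty h, forall x, h (phi q%:R^-1 x) = phi q%:R^-1 (h x),
      measurable E, (torus_measure E < delta%:E)%E &
      forall x, ~ E x -> torus_dist (h x) (hh x) <= eps / 2].
  case: d hh hh_slide hh_phi => [|d'] hh hh_slide hh_phi; last first.
    apply: analytic_approximation => //; last by rewrite divr_gt0.
    by move=> x; exact: (congr1 (@^~ x) hh_phi).
  exists id, set0; split => //.
  - exact/trig_diffeo_Diff_omega/trig_diffeo_id.
  - by rewrite /torus_measure preimage_set0 set0I measure0 lte_fin.
  - move=> x _; rewrite (block_slide_dim1 hh_slide).
    apply: le_trans (torus_dist_close (lexx 0) (close_refl x)) _.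
    by rewrite mulr0 divr_ge0// ltW.
exists h; split => //; last exact/funext.
exists E; split => //.
apply: (@le_lt_trans _ _ (eps / 2)%:E).
  by apply: ge_ereal_sup => _ [x nE <-]; rewrite lee_fin; exact: hE.
by rewrite lte_fin ltr_pdivrMr// ltr_pMr// ltr1n.
Qed.
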